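(* Let $f$ be an octonion-valued slice regular function on $\mathbb B=\{w\in\mathbb O:|w|<1\}$ such that $\widehat d\big(f(\mathbb B)\big)=2$, where $\widehat d$ denotes the slice diameter. Then $$\mathrm{diam}\, f(r\mathbb B_I)\leq 2r\qquad\text{for each } r\in(0,1)\text{ and each } I\in\mathbb S, \tag{a}$$ and $$|f'(0)|\leq 1. \tag{b}$$ Moreover, equality holds in (a) for some $r_0\in(0,1)$ and some $I_0\in\mathbb S$, or in (b), if and only if $f$ is an affine function $f(w)=f(0)+wf'(0)$.
   Context: $\mathbb O$ is the real division algebra of octonions, with norm $|w|$. $\mathbb S=\{w\in\mathbb O:w^2=-1\}$; for $I\in\mathbb S$, $\mathbb C_I=\mathbb R\oplus I\mathbb R$ and $\Omega_I=\Omega\cap\mathbb C_I$ for $\Omega\subseteq\mathbb O$. $f:\Omega\to\mathbb O$ on a domain $\Omega\subseteq\mathbb O$ is slice regular if for every $I\in\mathbb S$ its restriction $f_I$ to $\Omega_I$ has continuous partial derivatives and $\frac12(\frac{\partial}{\partial x}+I\frac{\partial}{\partial y})f_I(x+yI)=0$ on $\Omega_I$. The slice derivative is $f'(x+yI)=\frac12(\frac{\partial}{\partial x}-I\frac{\partial}{\partial y})f_I(x+yI)$. For $E\subseteq\mathbb O$, $\mathrm{diam}\,E=\sup_{z,w\in E}|z-w|$ is the Euclidean diameter. The slice diameter of the image of $\Omega$ under $f$ is $\widehat d\big(f(\Omega)\big)=\sup_{I\in\mathbb S}\mathrm{diam}\, f(\Omega_I)$. *)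

(* Defs.v *)
From HB Require Import structures.
From mathcomp Require Import all_boot all_order all_algebra.
From mathcomp Require Import all_classical all_reals all_analysis.
From mathcomp Require Import ring lra.
Set Implicit Arguments.
Unset Strict Implicit.
Unset Printing Implicit Defensive.
Import Order.TTheory GRing.Theory Num.Theory.
Import numFieldNormedType.Exports.
Local Open Scope classical_set_scope.
Local Open Scope ring_scope.

(* 'rV[R]_(4 + 4) supplies the real vector space and the topology.  Its
   library norm `|w| is the sup norm; the octonion norm is onorm below. *)
Notation octonion R := 'rV[R]_(4 + 4).

Section Octonions.
Variable R : realType.
Implicit Types (p q : 'rV[R]_4) (u v w I : octonion R).

Definition qmul p q : 'rV[R]_4 :=
  let x k := p 0 (inord k) in let y k := q 0 (inord k) in
  \row_k [:: x 0%N * y 0%N - x 1%N * y 1%N - x 2%N * y 2%N - x 3%N * y 3%N;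
             x 0%N * y 1%N + x 1%N * y 0%N + x 2%N * y 3%N - x 3%N * y 2%N;
             x 0%N * y 2%N - x 1%N * y 3%N + x 2%N * y 0%N + x 3%N * y 1%N;
             x 0%N * y 3%N + x 1%N * y 2%N - x 2%N * y 1%N + x 3%N * y 0%N]`_k.

Definition qconj p : 'rV[R]_4 :=
  let x k := p 0 (inord k) in \row_k [:: x 0%N; - x 1%N; - x 2%N; - x 3%N]`_k.

(* Cayley-Dickson doubling: (a, b) (c, d) = (a c - d^* b, d a + b c^* ) *)
Definition omul u v : octonion R :=
  let a : 'rV[R]_4 := lsubmx u in let b : 'rV[R]_4 := rsubmx u in
  let c : 'rV[R]_4 := lsubmx v in let d : 'rV[R]_4 := rsubmx v in
  row_mx (qmul a c - qmul (qconj d) b) (qmul d a + qmul b (qconj c)).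

Definition oone : octonion R := delta_mx 0 0.

Definition oreal (x : R) : octonion R := x *: oone.

Definition ore w : R := w 0 0.

Definition oim w : octonion R := w - oreal (ore w).

Definition onorm w : R := Num.sqrt (\sum_k w 0 k ^+ 2).

Definition oball : set (octonion R) := [set w | onorm w < 1].

Definition imag_sphere : set (octonion R) := [set I | omul I I = - oone].

Definition cpoint I (x y : R) : octonion R := oreal x + y *: I.

Definition cplane I : set (octonion R) := [set cpoint I p.1 p.2 | p in [set: R * R]].

Definition slice (Omega : set (octonion R)) I : set (octonion R) :=
  Omega `&` cplane I.

Section SliceRegular.
Variable f : octonion R -> octonion R.

Definition slice_dx I (x y : R) : octonion R :=
  derive1 (fun t : R => f (cpoint I t y)) x.

Definition slice_dy I (x y : R) : octonion R :=
  derive1 (fun t : R => f (cpoint I x t)) y.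

(* Meant for open Omega, so that the derivatives at points of the slice of
   Omega depend only on the restriction of f to that slice. *)
Definition slice_regular (Omega : set (octonion R)) : Prop :=
  forall I, imag_sphere I -> forall x y : R, Omega (cpoint I x y) ->
  [/\ derivable (fun t : R => f (cpoint I t y)) x 1,
      derivable (fun t : R => f (cpoint I x t)) y 1,
      {for (x, y), continuous (fun p : R * R => slice_dx I p.1 p.2)},
      {for (x, y), continuous (fun p : R * R => slice_dy I p.1 p.2)} &
      2^-1 *: (slice_dx I x y + omul I (slice_dy I x y)) = 0].

Definition slice_deriv_on I (x y : R) : octonion R :=
  2^-1 *: (slice_dx I x y - omul I (slice_dy I x y)).

(* For non-real w this is the I with w = Re w + |Im w| I; for real w any I
   will do, see slice_derivE. *)
Definition imag_unit w : octonion R :=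
  if oim w == 0 then delta_mx 0 (inord 1) else (onorm (oim w))^-1 *: oim w.

Definition slice_deriv w : octonion R :=
  slice_deriv_on (imag_unit w) (ore w) (onorm (oim w)).

End SliceRegular.

Definition diam (E : set (octonion R)) : \bar R :=
  ereal_sup [set (onorm (p.1 - p.2))%:E | p in E `*` E].

Definition slice_diam (f : octonion R -> octonion R)
    (Omega : set (octonion R)) : \bar R :=
  ereal_sup [set diam (f @` slice Omega I) | I in imag_sphere].

End Octonions.

Ltac generalize_entries u :=
  generalize (u 0 (inord 0)) (u 0 (inord 1)) (u 0 (inord 2)) (u 0 (inord 3))
             (u 0 (inord 4)) (u 0 (inord 5)) (u 0 (inord 6)) (u 0 (inord 7)).

Section OctonionTheory.
Variable R : realType.
Implicit Types (u v w I : octonion R) (f : octonion R -> octonion R).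

Lemma lshift_inord k : (k < 4)%N ->
  lshift 4 (inord k) = inord k :> 'I_(4 + 4).
Proof. by move=> k4; apply/val_inj; rewrite /= !inordK// (leq_trans k4). Qed.

Lemma rshift_inord k : (k < 4)%N ->
  rshift 4 (inord k) = inord (4 + k) :> 'I_(4 + 4).
Proof. by move=> k4; apply/val_inj; rewrite /= !inordK// ltn_add2l. Qed.

Lemma omulE u v :
  let x k := u 0 (inord k) in let y k := v 0 (inord k) in
  omul u v = \row_k
  [:: x 0%N * y 0%N - x 1%N * y 1%N - x 2%N * y 2%N - x 3%N * y 3%N
       - x 4%N * y 4%N - x 5%N * y 5%N - x 6%N * y 6%N - x 7%N * y 7%N;
     x 0%N * y 1%N + x 1%N * y 0%N + x 2%N * y 3%N - x 3%N * y 2%N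
       + x 4%N * y 5%N - x 5%N * y 4%N - x 6%N * y 7%N + x 7%N * y 6%N;
     x 0%N * y 2%N - x 1%N * y 3%N + x 2%N * y 0%N + x 3%N * y 1%N
       + x 4%N * y 6%N + x 5%N * y 7%N - x 6%N * y 4%N - x 7%N * y 5%N;
     x 0%N * y 3%N + x 1%N * y 2%N - x 2%N * y 1%N + x 3%N * y 0%N
       + x 4%N * y 7%N - x 5%N * y 6%N + x 6%N * y 5%N - x 7%N * y 4%N;
     x 0%N * y 4%N - x 1%N * y 5%N - x 2%N * y 6%N - x 3%N * y 7%N
       + x 4%N * y 0%N + x 5%N * y 1%N + x 6%N * y 2%N + x 7%N * y 3%N;
     x 0%N * y 5%N + x 1%N * y 4%N - x 2%N * y 7%N + x 3%N * y 6%N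
       - x 4%N * y 1%N + x 5%N * y 0%N - x 6%N * y 3%N + x 7%N * y 2%N;
     x 0%N * y 6%N + x 1%N * y 7%N + x 2%N * y 4%N - x 3%N * y 5%N
       - x 4%N * y 2%N + x 5%N * y 3%N + x 6%N * y 0%N - x 7%N * y 1%N;
     x 0%N * y 7%N - x 1%N * y 6%N + x 2%N * y 5%N + x 3%N * y 4%N
       - x 4%N * y 3%N - x 5%N * y 2%N + x 6%N * y 1%N + x 7%N * y 0%N]`_k.
Proof.
move=> x y; apply/rowP => i; rewrite [RHS]mxE.
case: (split_ordP i) => j ->; [rewrite row_mxEl|rewrite row_mxEr];
  rewrite !mxE /=.
all: rewrite ?inordK//= ?lshift_inord// ?rshift_inord//.
all: case: j => [[|[|[|[|//]]]] jn] /=.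
all: have [e0 e1 e2 e3] : [/\ 4 + 0 = 4, 4 + 1 = 5, 4 + 2 = 6 & 4 + 3 = 7]%N
  by [].
all: rewrite /x /y ?e0 ?e1 ?e2 ?e3.
all: by clear; generalize_entries u; generalize_entries v => *; ring.
Qed.

Lemma onormE u : let x k := u 0 (inord k) in
  onorm u = Num.sqrt (x 0%N ^+ 2 + x 1%N ^+ 2 + x 2%N ^+ 2 + x 3%N ^+ 2
                    + x 4%N ^+ 2 + x 5%N ^+ 2 + x 6%N ^+ 2 + x 7%N ^+ 2).
Proof.
rewrite /onorm; congr Num.sqrt.
under eq_bigr do rewrite -[X in u 0 X]inord_val.
by rewrite !big_ord_recl big_ord0 addr0 /= !addrA.
Qed.

Lemma onormM u v : onorm (omul u v) = onorm u * onorm v.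
Proof.
rewrite omulE !onormE !mxE !inordK//= -sqrtrM; last first.
  by rewrite !addr_ge0// sqr_ge0.
by congr Num.sqrt; clear; generalize_entries u; generalize_entries v => *; ring.
Qed.

Lemma onormZ a u : onorm (a *: u) = `|a| * onorm u.
Proof.
rewrite /onorm -sqrtr_sqr -sqrtrM ?sqr_ge0// mulr_sumr; congr Num.sqrt.
by apply: eq_bigr => k _; rewrite mxE exprMn.
Qed.

Lemma onorm_oone : onorm (oone R) = 1.
Proof.
rewrite /onorm (bigD1 0)//= big1 => [|k k0].
  by rewrite !mxE !eqxx expr1n addr0 sqrtr1.
by rewrite mxE eqxx/= (negbTE k0) expr0n.
Qed.

Lemma omulNr u v : omul u (- v) = - omul u v.
Proof.
apply/rowP => i; rewrite 2!omulE [LHS]mxE [RHS]mxE [in RHS]mxE !(mxE _ _ 0 _).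
case: i => [[|[|[|[|[|[|[|[|//]]]]]]]] ?] /=;
  by clear; generalize_entries u; generalize_entries v => *; ring.
Qed.

Lemma omulNl u v : omul (- u) v = - omul u v.
Proof.
apply/rowP => i; rewrite 2!omulE [LHS]mxE [RHS]mxE [in RHS]mxE.
case: i => [[|[|[|[|[|[|[|[|//]]]]]]]] ?] /=; rewrite !mxE;
  by clear; generalize_entries u; generalize_entries v => *; ring.
Qed.

Lemma ord0_inord : 0 = inord 0 :> 'I_(4 + 4).
Proof. by apply/val_inj; rewrite /= inordK. Qed.

Lemma imag_sphere_ore_onorm I : imag_sphere I -> ore I = 0 /\ onorm I = 1.
Proof.
move=> II; have n1 : onorm I = 1.
  apply/eqP; rewrite -(@eqrXn2 _ 2%N) ?sqrtr_ge0// expr1n expr2 -onormM II.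
  by rewrite -scaleN1r onormZ onorm_oone normrN1 mulr1.
split=> //; rewrite /ore ord0_inord; apply/eqP/negPn/negP => x0.
have xk k : (0 < k < 8)%N -> I 0 (inord k) = 0.
  move=> /andP[k0 k8]; have : omul I I 0 (inord k) = 0.
    rewrite II !mxE -!val_eqE /= inordK//.
    by case: k k0 {k8} => // k _; rewrite oppr0.
  rewrite omulE mxE inordK//.
  have x0' : 2 * I 0 (inord 0) != 0 by rewrite mulf_neq0// pnatr_eq0.
  case: k k0 k8 => [|[|[|[|[|[|[|[|//]]]]]]]]//= _ _ H;
    by apply: (mulfI x0'); rewrite mulr0 -[RHS]H; clear;
       generalize_entries I => *; ring.
have : omul I I 0 (inord 0) = -1.
  by rewrite II !mxE -!val_eqE /= inordK.
rewrite omulE mxE inordK//= (xk 1%N)// (xk 2%N)// (xk 3%N)// (xk 4%N)// (xk 5%N)// (xk 6%N)// (xk 7%N)//.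
rewrite !mulr0 !subr0 => H.
by have := sqr_ge0 (I 0 (inord 0)); rewrite expr2 H oppr_ge0 ler10.
Qed.

Lemma imag_unit0 : imag_sphere (imag_unit (0 : octonion R)).
Proof.
rewrite /imag_sphere/= /imag_unit /oim /ore /oreal mxE scale0r subr0 eqxx.
apply/rowP => i; rewrite omulE !mxE -!val_eqE /= !inordK//=.
by case: i => [[|[|[|[|[|[|[|[|//]]]]]]]] ?] /=; rewrite !(mulr0, mul0r, mulr1, subr0, addr0, sub0r, oppr0).
Qed.

Lemma cpointN I x y : cpoint (- I) x (- y) = cpoint I x y.
Proof. by rewrite /cpoint scalerN scaleNr opprK. Qed.

Lemma slice_deriv_onN f I x y :
    derivable (fun t : R => f (cpoint I x t)) y 1 ->
  slice_deriv_on f (- I) x (- y) = slice_deriv_on f I x y.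
Proof.
move=> df.
have dx : slice_dx f (- I) x (- y) = slice_dx f I x y.
  rewrite /slice_dx; congr (derive1 _ x).
  by apply/funext => t; rewrite cpointN.
have dy : slice_dy f (- I) x (- y) = - slice_dy f I x y.
  rewrite /slice_dy.
  have -> : derive1 (fun t => f (cpoint (- I) x t)) (- y) =
            'D_(-1) (fun t => f (cpoint I x t)) y.
    rewrite derive1E /derive.
    set q1 := (X in lim (X @ _)); set q2 := (X in _ = lim (X @ _)).
    have cN t : cpoint (- I) x t = cpoint I x (- t) by rewrite -cpointN opprK.
    have -> // : q1 = q2.
    by apply/funext => h; rewrite /q1 /q2 /= !cN opprD opprK scalerN.
  move/derivable1_diffP: df => dg.
  by rewrite deriveE// linearN -derive1E'.
by rewrite /slice_deriv_on dx dy omulNl omulNr opprK.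
Qed.

Lemma slice_deriv_on_real f I x :
    2^-1 *: (slice_dx f I x 0 + omul I (slice_dy f I x 0)) = 0 ->
  slice_deriv_on f I x 0 = derive1 (f \o @oreal R) x.
Proof.
move=> /eqP; rewrite scaler_eq0 invr_eq0 pnatr_eq0/= addrC addr_eq0 => /eqP CR.
rewrite /slice_deriv_on CR opprK scalerDr -scalerDl.
have -> : 2^-1 + 2^-1 = 1 :> R by field.
rewrite scale1r /slice_dx; congr (derive1 _ x); apply/funext => t /=.
by rewrite /cpoint scale0r addr0.
Qed.

Lemma slice_derivE (Omega : set (octonion R)) f I x y :
    slice_regular f Omega -> imag_sphere I -> Omega (cpoint I x y) ->
  slice_deriv f (cpoint I x y) = slice_deriv_on f I x y.
Proof.
move=> fr SI Oxy; have [I0 I1] := imag_sphere_ore_onorm SI.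
have rE : ore (cpoint I x y) = x.
  by rewrite /ore /cpoint !mxE !eqxx mulr1 [I 0 0]I0 mulr0 addr0.
have iE : oim (cpoint I x y) = y *: I.
  by rewrite /oim rE /cpoint addrAC subrr add0r.
have I_neq0 : I != 0.
  apply: contra_eq_neq I1 => ->.
  by rewrite -(scale0r (oone R)) onormZ normr0 mul0r eq_sym oner_eq0.
rewrite /slice_deriv rE iE onormZ I1 mulr1.
have [y0|y0|y0] := ltgtP y 0.
- rewrite /imag_unit iE scaler_eq0 (lt_eqF y0) (negbTE I_neq0) onormZ I1 mulr1.
  have -> : `|y|^-1 *: (y *: I) = - I.
    by rewrite scalerA (ltr0_norm y0) invrN mulNr mulVf ?(lt_eqF y0)// scaleN1r.
  rewrite (ltr0_norm y0).
  by apply: slice_deriv_onN; have [] := fr _ SI _ _ Oxy.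
- rewrite /imag_unit iE scaler_eq0 (gt_eqF y0) (negbTE I_neq0) onormZ I1 mulr1.
  have -> : `|y|^-1 *: (y *: I) = I.
    by rewrite scalerA (gtr0_norm y0) mulVf ?(gt_eqF y0)// scale1r.
  by rewrite (gtr0_norm y0).
- rewrite {}y0 in iE Oxy *; rewrite normr0.
  have S0 : imag_sphere (imag_unit (cpoint I x 0)).
    have -> : imag_unit (cpoint I x 0) = imag_unit 0.
      rewrite /imag_unit iE scale0r eqxx ifT//.
      by rewrite /oim /ore /oreal mxE scale0r subr0.
    exact: imag_unit0.
  move: S0; set J := imag_unit _ => SJ.
  have OJ : Omega (cpoint J x 0) by move: Oxy; rewrite /cpoint !scale0r.
  have [_ _ _ _ CRI] := fr I SI x 0 Oxy.
  have [_ _ _ _ CRJ] := fr J SJ x 0 OJ.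
  exact: etrans (slice_deriv_on_real CRJ) (esym (slice_deriv_on_real CRI)).
Qed.

End OctonionTheory.

(* Main.v *)
(** For [I] in the sphere [S], left multiplication by [I] makes the octonions a
    complex vector space, and the components [<f_I, u> + i <f_I, I u>] of a slice
    regular function are holomorphic on the unit disc.  The Schwarz lemma applied
    to the components of [lambda |-> f_I (lambda z) - f_I (lambda w)] gives (a)
    and (b), and equality in (a), attained by compactness, forces equality in (b).

    Let [|a| = 1], where [a = f'(0)].  By equality in the Schwarz lemma,
    [f_I (z) - f_I (- z)] and [2 z a] have the same component along [z a], while
    [|f_I (z) - f_I (w)| <= 2 |z|] when [|w| = |z|].  So [w = - z] is extremal on
    this circle, and the angular derivative there shows that [f_I'] is orthogonal
    to [I a]; by the Cauchy-Riemann equations its component along [a] is then 1.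
    A single slice does not control the remaining components: it is because all
    slices share the real axis, and [a] and the [I a] together span the octonions,
    that [f' = a] there.  The identity theorem concludes on every slice.

    The derivatives are only assumed to be continuous, so the mean value property
    comes from differentiating the circular mean under the integral sign. *)

From HB Require Import structures.
Require Import Defs.
From mathcomp Require Import all_boot all_order all_algebra.
From mathcomp Require Import all_classical all_reals all_analysis.
From mathcomp Require Import ring lra.
Import Order.TTheory GRing.Theory Num.Theory.
Import numFieldNormedType.Exports.
Local Open Scope classical_set_scope.
Local Open Scope ring_scope.
Set Implicit Arguments.
Unset Strict Implicit.

(* mathcomp-analysis has an unrelated [cpoint]. *)
Local Notation cpoint := Defs.cpoint.

(** * Differentiable functions of two variables *)

Section Differential2.
Variable R : realType.
Implicit Types (P Q A B : R * R -> R) (z w c : R * R) (e : R).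

(** Differentials are kept in this form, which displays the two partial derivatives. *)
Definition lin2 (a b : R) (v : R * R) : R := a * v.1 + b * v.2.

Lemma lin2_is_linear a b : linear (lin2 a b).
Proof. by move=> k [u1 u2] [v1 v2]; rewrite /lin2 /= /GRing.scale /=; ring. Qed.

HB.instance Definition _ a b :=
  GRing.isLinear.Build R (R * R)%type R _ (lin2 a b) (lin2_is_linear a b).

Lemma lin2_continuous a b : continuous (lin2 a b).
Proof.
by move=> v; apply: cvgD; apply: cvgM; try exact: cvg_cst;
  [exact: cvg_fst|exact: cvg_snd].
Qed.

Lemma continuous_pair (T : topologicalType) (f1 f2 : T -> R) (x : T) :
  {for x, continuous f1} -> {for x, continuous f2} ->
  {for x, continuous (fun y => (f1 y, f2 y))}.
Proof. by move=> h1 h2; exact: (@cvg_pair _ _ _ _ _ _ _ _ _ _ _ h1 h2). Qed.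

(** The little-o expansion spelled out with epsilons; in the converse direction, uniqueness of the
    differential identifies it with the candidate. *)
Lemma is_diff_lin2P P z a b :
  is_diff z P (lin2 a b) <->
  forall e, 0 < e -> \forall w \near z,
    `|P w - P z - lin2 a b (w - z)| <= e * `|w - z|.
Proof.
split.
- move=> dP e e0.
  have := diff_locally (ex_diff (is_diff_def := dP)).
  rewrite diff_val => /eqaddoP /(_ e e0).
  rewrite [in X in _ -> X](near_shift 0 z) subr0 /=.
  by apply: filterS => v /=; rewrite !fctE /= addrK opprD addrA.
- move=> H.
  have cL := @lin2_continuous a b.
  have := @diff_unique R (R * R)%type R P (lin2 a b) z cL.
  have := (@diff_locallyP R (R * R)%type R z P).2.
  set E := (X in _ /\ X -> _) => Ed.
  set E' := (X in (X -> _) -> _).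
  have H' : E'.
    apply/eqaddoP => e e0; have := H e e0.
    rewrite (near_shift 0 z) subr0 /=.
    move=> /nbhs_ballP[d d0 Hd]; apply/nbhs_ballP; exists d => // v /Hd /=.
    by rewrite !fctE /= addrK -addrA -opprD.
  move=> /(_ H') dE.
  by apply: DiffDef => //; apply: Ed; rewrite /E dE.
Qed.

(* Continuous partial derivatives give differentiability; the increment is
   split along the horizontal and then the vertical direction. *)
Lemma partial_is_diff P A B z :
  (\forall w \near z, is_derive (w.1 : R) 1 (fun t => P (t, w.2)) (A w)) ->
  (\forall w \near z, is_derive (w.2 : R) 1 (fun t => P (w.1, t)) (B w)) ->
  {for z, continuous A} -> {for z, continuous B} ->
  is_diff z P (lin2 (A z) (B z)).
Proof.
move=> dA dB cA cB; apply/is_diff_lin2P => e e0.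
have e20 : 0 < e / 2 by rewrite divr_gt0.
move/cvgrPdist_le : cA => /(_ _ e20) cA.
move/cvgrPdist_le : cB => /(_ _ e20) cB.
have [d /= d0 H] := (nbhs_ballP _ _).1 (filterI (filterI dA dB) (filterI cA cB)).
apply/nbhs_ballP; exists d => //= -[x y] [/= bx by_].
have Hx t : ball z.1 d t -> is_derive t 1 (fun s => P (s, y)) (A (t, y)) /\
    `|A z - A (t, y)| <= e / 2.
  by move=> bt; have [[? _] [? _]] := H (t, y) (conj bt by_).
have Hy t : ball z.2 d t -> is_derive t 1 (fun s => P (z.1, s)) (B (z.1, t)) /\
    `|B z - B (z.1, t)| <= e / 2.
  by move=> bt; have [[_ ?] [_ ?]] := H (z.1, t) (conj (ballxx _ d0) bt).
(* By the mean value theorem, closeness of [dg] to the constant [k] controls the increment; this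
   serves both the horizontal and the vertical direction. *)
have key (a b k : R) (g dg : R -> R) : ball a d b ->
    (forall t, ball a d t -> is_derive t 1 g (dg t) /\ `|k - dg t| <= e / 2) ->
    `|g b - g a - k * (b - a)| <= e / 2 * `|b - a|.
  move=> bb Hg.
  have hgt u v t : ball a d u -> ball a d v -> t \in `[u, v]%R -> ball a d t.
    rewrite !ball_itv /= !in_itv /= => /andP[u1 u2] /andP[v1 v2] /andP[t1 t2].
    by apply/andP; split; lra.
  have mvt u v : u <= v -> ball a d u -> ball a d v ->
      exists2 t, ball a d t & g v - g u = dg t * (v - u).
    move=> uv bu bv.
    have [|| t tuv tE] := @MVT_segment R g dg u v uv.
    - by move=> t tuv; apply: (Hg t _).1; apply: (hgt u v) => //;
        exact: subset_itv_oo_cc.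
    - apply: derivable_within_continuous => t tuv.
      by have [[]] := Hg t (hgt u v t bu bv tuv).
    - by exists t => //; exact: (hgt u v).
  have ba : ball a d a by exact: ballxx.
  have [t bt ->] : exists2 t, ball a d t & g b - g a = dg t * (b - a).
    have [ab|/ltW ba'] := leP a b; first exact: mvt.
    have [t bt tE] := mvt b a ba' bb ba; exists t => //.
    by rewrite -opprB tE -mulrN opprB.
  rewrite -mulrBl normrM ler_wpM2r// distrC; exact: (Hg t bt).2.
have kx := key _ _ _ _ _ bx Hx.
have ky := key _ _ _ _ _ by_ Hy.
have -> : P (x, y) - P z - lin2 (A z) (B z) ((x, y) - z) =
   (P (x, y) - P (z.1, y) - A z * (x - z.1)) +
   (P (z.1, y) - P (z.1, z.2) - B z * (y - z.2)).
  by rewrite /lin2 /= -surjective_pairing; ring.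
rewrite (le_trans (ler_normD _ _))// (le_trans (lerD kx ky))//.
have n1 : `|x - z.1| <= `|(x, y) - z| by rewrite prod_normE /= le_max lexx.
have n2 : `|y - z.2| <= `|(x, y) - z| by rewrite prod_normE /= le_max lexx orbT.
by nra.
Qed.

(** Chain rule along a curve. The point is tied to the curve by an equation, so that the rule also
    applies at a [z] that is not literally a pair. *)
Lemma is_diff_path P z a b (g1 g2 : R -> R) (t d1 d2 : R) :
  is_diff z P (lin2 a b) -> is_derive t 1 g1 d1 -> is_derive t 1 g2 d2 ->
  z = (g1 t, g2 t) ->
  is_derive t 1 (fun s => P (g1 s, g2 s)) (a * d1 + b * d2).
Proof.
move=> dP dg1 dg2 zE.
have D1 : is_diff t g1 ( *:%R ^~ d1).
  apply: DiffDef; first by apply/derivable1_diffP; case: dg1.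
  by rewrite deriv1E ?derive1E ?derive_val//; case: dg1.
have D2 : is_diff t g2 ( *:%R ^~ d2).
  apply: DiffDef; first by apply/derivable1_diffP; case: dg2.
  by rewrite deriv1E ?derive1E ?derive_val//; case: dg2.
have dP' : is_diff (g1 t, g2 t) P (lin2 a b) by rewrite -zE.
have D : is_diff t (P \o (fun s => (g1 s, g2 s)))
   (lin2 a b \o (fun s => (s *: d1, s *: d2))).
  exact: is_diff_comp.
apply: DeriveDef; first by apply/derivable1_diffP.
rewrite deriveE; last by [].
by rewrite diff_val /= /lin2 /= !scale1r.
Qed.

(** Mean value theorem between 0 and [x], for either sign of [x]; the range is written with squares
    because discs are described by [nsq]. *)
Lemma derive0_eq (g : R -> R) (x : R) :
  (forall s : R, s ^+ 2 <= x ^+ 2 -> is_derive s 1 g 0) -> g x = g 0.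
Proof.
move=> H; have bd (s : R) : `|s| <= `|x| -> is_derive s 1 g 0.
  by move=> sx; apply: H; rewrite -[leLHS]real_normK ?num_real//
    -[leRHS]real_normK ?num_real// ler_pXn2r// nnegrE.
have H' (s : R) : s \in `[- `|x|, `|x|]%R -> is_derive s 1 g 0.
  by rewrite in_itv /= -ler_norml; exact: bd.
have mvt (b c : R) : - `|x| <= b -> c <= `|x| -> b <= c -> g b = g c.
  move=> xb cx bc; have sub (s : R) : s \in `[b, c]%R -> is_derive s 1 g 0.
    rewrite in_itv /= => /andP[bs sc]; apply: H'; rewrite in_itv /=.
    by rewrite (le_trans xb bs) (le_trans sc cx).
  have cg : {within `[b, c], continuous g}.
    by apply: derivable_within_continuous => s /sub[].
  have dg s (hs : s \in `]b, c[%R) : is_derive s 1 g 0 := sub s (subset_itv_oo_cc hs).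
  have [s _] := @MVT_segment R g (fun=> 0) b c bc dg cg.
  by rewrite mul0r => /subr0_eq.
have nx : - `|x| <= x by have := ler_norm (- x); rewrite normrN; lra.
have xn := ler_norm x; have n0 := normr_ge0 x.
have [x0|/ltW x0] := leP 0 x; first by apply/esym; apply: mvt => //; lra.
by apply: mvt => //; lra.
Qed.

End Differential2.

(** * The mean value property *)

Section MeanValue.
Variable R : realType.
Implicit Types (P Q A B : R * R -> R) (z w c : R * R) (U : set (R * R)) (t s : R).

(** The squared Euclidean modulus; the library norm of a pair is the maximum of its coordinates. *)
Definition nsq z : R := z.1 ^+ 2 + z.2 ^+ 2.

(* [P + i Q] is holomorphic on [U] with derivative [A + i B], and the
   derivative is continuous. *)
Definition holo U P Q A B := forall z, U z ->
  [/\ is_diff z P (lin2 (A z) (- B z)), is_diff z Q (lin2 (B z) (A z)),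
      {for z, continuous A} & {for z, continuous B}].

Lemma holo_sub U V P Q A B : V `<=` U -> holo U P Q A B -> holo V P Q A B.
Proof. by move=> VU h z /VU /h. Qed.

Let mu := @lebesgue_measure R.

Section Circles.
Variables (T : R) (P Q A B : R * R -> R).
Hypothesis h : holo [set z | 0 < nsq z < T ^+ 2] P Q A B.

Let g (t s : R) : R * R := (t * cos s, t * sin s).

Lemma nsq_circle t s : nsq (t * cos s, t * sin s) = t ^+ 2.
Proof. by rewrite /nsq /= !exprMn -mulrDr cos2Dsin2 mulr1. Qed.

Let gV t s : 0 < t < T -> [set z | 0 < nsq z < T ^+ 2] (g t s).
Proof.
move=> /andP[t0 tT]; rewrite /= nsq_circle exprn_gt0//=.
by rewrite ltrXn2r// ltW.
Qed.

Let dr t s : 0 < t < T ->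
  is_derive t 1 (fun t => P (g t s)) (A (g t s) * cos s - B (g t s) * sin s).
Proof.
move=> tT; have [dP _ _ _] := h (gV s tT).
rewrite -mulNr.
apply: (is_diff_path dP (g1 := fun t => t * cos s) (g2 := fun t => t * sin s)).
- by apply: is_derive_eq; rewrite scaler0 add0r /GRing.scale /= mulr1.
- by apply: is_derive_eq; rewrite scaler0 add0r /GRing.scale /= mulr1.
- by [].
Qed.

(** Cauchy-Riemann in polar coordinates: the angular derivative of [Q] is [t] times the radial
    derivative of [P]. *)
Let ds t s : 0 < t < T ->
  is_derive s 1 (fun s => Q (g t s)) (t * (A (g t s) * cos s - B (g t s) * sin s)).
Proof.
move=> tT; have [_ dQ _ _] := h (gV s tT).
have -> : t * (A (g t s) * cos s - B (g t s) * sin s) =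
  B (g t s) * (- (t * sin s)) + A (g t s) * (t * cos s) by ring.
apply: (is_diff_path dQ (g1 := fun s => t * cos s) (g2 := fun s => t * sin s)).
- by apply: is_derive_eq; rewrite /GRing.scale /= mulrN.
- by [].
Qed.


Let dsP t s : 0 < t < T -> derivable (fun s => P (g t s)) s 1.
Proof.
move=> tT; have [dP _ _ _] := h (gV s tT).
suff [] : is_derive s 1 (fun s => P (g t s))
  (A (g t s) * (- (t * sin s)) + - B (g t s) * (t * cos s)) by [].
apply: (is_diff_path dP (g1 := fun s => t * cos s) (g2 := fun s => t * sin s)).
- by apply: is_derive_eq; rewrite /GRing.scale /= mulrN.
- by [].
Qed.

Lemma continuous_polar : continuous (fun p : R * R => g p.1 p.2).
Proof.
have cc (k : R -> R) : continuous k -> continuous (fun p : R * R => p.1 * k p.2).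
  move=> ck p; apply: cvgM; first exact: cvg_fst.
  by apply: (@continuous_comp _ _ _ (@snd R R) k); [exact: cvg_snd|exact: ck].
move=> p; refine (@continuous_pair R (R * R)%type (fun p => p.1 * cos p.2)
  (fun p => p.1 * sin p.2) p _ _); apply: cc; [exact: continuous_cos|exact: continuous_sin].
Qed.

Let I : set R := `[- pi, pi].

Let intP t : 0 < t < T -> mu.-integrable I (EFin \o (fun s => P (g t s))).
Proof.
move=> tT; apply: continuous_compact_integrable; first exact: segment_compact.
by apply: derivable_within_continuous => s _; exact: dsP.
Qed.

Let D t s := A (g t s) * cos s - B (g t s) * sin s.

Let continuousD t s : 0 < t < T -> {for (t, s), continuous (fun p => D p.1 p.2)}.
Proof.
move=> tT; have [_ _ cA cB] := h (gV s tT).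
have cp := @continuous_polar (t, s).
have c2 (k : R -> R) : continuous k -> {for (t, s), continuous (fun p : R * R => k p.2)}.
  move=> ck.
  by apply: (@continuous_comp _ _ _ (@snd R R) k); [exact: cvg_snd|exact: ck].
apply: cvgB; apply: cvgM.
- exact: (@continuous_comp _ _ _ _ A _ cp cA).
- exact: (c2 _ (@continuous_cos R)).
- exact: (@continuous_comp _ _ _ _ B _ cp cB).
- exact: (c2 _ (@continuous_sin R)).
Qed.

(** The radial derivative of [P] is the angular derivative of [Q / t], which takes the same value at
    both ends of the interval. *)
Let intD t : 0 < t < T -> \int[mu]_(s in I) D t s = 0.
Proof.
move=> tT; have t0 : t != 0 by case/andP: tT => /gt_eqF ->.
have pi2 : - pi < pi :> R by rewrite gtrN// pi_gt0.
have dQ s : is_derive s 1 (fun s => t^-1 * Q (g t s)) (D t s).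
  apply: (is_derive_eq (is_deriveZ t^-1 (ds s tT))).
  by rewrite /GRing.scale /= mulKf.
have cD : {within I, continuous (D t)}.
  apply/continuous_in_subspaceT => s _.
  have cp : {for s, continuous (fun s => (t, s))}.
    by refine (@continuous_pair R R (fun=> t) id s _ _); [exact: cvg_cst|exact: cvg_id].
  have := @continuous_comp _ _ _ _ (fun p => D p.1 p.2) _ cp (@continuousD t s tT).
  by apply.
have cQ : continuous (fun s => t^-1 * Q (g t s)).
  by move=> s; apply/differentiable_continuous/derivable1_diffP; case: (dQ s).
rewrite /Rintegral (continuous_FTC2 (F := fun s => t^-1 * Q (g t s)) pi2 cD).
- by rewrite /g cosN sinN sinpi oppr0 subee//=.
- split.
  + by move=> s _; case: (dQ s).
  + by apply/cvg_at_right_filter/cQ.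
  + by apply/cvg_at_left_filter/cQ.
- by move=> s _; rewrite derive1E; case: (dQ s).
Qed.


Let M t := \int[mu]_(s in I) P (g t s).

(** Differentiation under the integral sign: the radial derivative is dominated by the maximum of
    [|A| + |B|] over a compact annulus, and its integral vanishes by [intD]. *)
Let dM t : 0 < t < T -> is_derive t 1 M 0.
Proof.
move=> tT; have /andP[t0 t1] := tT.
pose u := t / 2; pose v := (t + T) / 2.
have u0 : 0 < u by rewrite divr_gt0.
have utv : u < t < v by rewrite /u /v; apply/andP; split; lra.
have uvT x : u <= x <= v -> 0 < x < T.
  by rewrite /u /v => /andP[ux xv]; apply/andP; split; lra.
pose N (p : R * R) := `|A (g p.1 p.2)| + `|B (g p.1 p.2)|.
pose K := `[u, v] `*` I.
have K0 : K !=set0.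
  by exists (t, 0); split; rewrite /I /= in_itv/= ?oppr_le0 ?pi_ge0//;
    move: utv => /andP[/ltW -> /ltW ->].
have cK : compact K by apply: compact_setX; exact: segment_compact.
have cN : {within K, continuous N}.
  apply/continuous_in_subspaceT => -[x s]; rewrite inE => -[/= xuv _].
  have [_ _ cA cB] := h (gV s (uvT x xuv)).
  have cp := @continuous_polar (x, s).
  by apply: cvgD; apply: cvg_norm;
    [exact: (@continuous_comp _ _ _ _ A _ cp cA)|
     exact: (@continuous_comp _ _ _ _ B _ cp cB)].
have [p _ pmax] := compact_EVT_max K0 cK cN.
have mI : measurable (I : set (measurableTypeR R)) by exact: measurable_itv.
have tuv : `]u, v[%classic t by rewrite /= in_itv.
have oc x : `]u, v[%classic x -> 0 < x < T.
  by rewrite /= in_itv /= => /andP[/ltW ux /ltW xv]; apply: uvT; rewrite ux.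
have intf x : `]u, v[%classic x -> mu.-integrable I (EFin \o (fun s => P (g x s))).
  by move=> /oc; exact: intP.
have df x s : `]u, v[%classic x -> I s -> derivable (fun x => P (g x s)) x 1.
  by move=> /oc xT _; case: (dr s xT).
have G0 : forall s : R, 0 <= N p by move=> _; rewrite addr_ge0.
have intG : mu.-integrable I (EFin \o (fun _ : R => N p)).
  apply: continuous_compact_integrable; first exact: segment_compact.
  by apply: continuous_subspaceT; exact: cst_continuous.
have dE x s : 0 < x < T -> partial1of2 (fun x s => P (g x s)) x s = D x s.
  by move=> xT; rewrite partial1of2E; case: (dr s xT).
have Gub x s : `]u, v[%classic x -> I s ->
    `|partial1of2 (fun x s => P (g x s)) x s| <= N p.
  move=> uxv Is; rewrite dE; last exact: oc.
  apply: le_trans (pmax (x, s) _); last first.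
    by rewrite inE; split => //=; apply: subset_itv_oo_cc.
  rewrite /D /N /= (le_trans (ler_normB _ _))// lerD// normrM ler_piMr//.
    by rewrite ler_norml cos_geN1 cos_le1.
  by rewrite ler_norml sin_geN1 sin_le1.
apply: DeriveDef.
  exact: (@derivable_under_integral R _ (measurableTypeR R)
    (@lebesgue_measure R) (fun x s => P (g x s)) I mI t u v tuv intf df (fun=> N p)
    G0 intG Gub).
rewrite -derive1E (@differentiation_under_integral R _ (measurableTypeR R)
    (@lebesgue_measure R) (fun x s => P (g x s)) I mI t u v tuv intf df (fun=> N p)
    G0 intG Gub).
by rewrite -[RHS](intD tT); apply: eq_Rintegral => s _; exact: dE.
Qed.

Let M_const t1 t2 : 0 < t1 < T -> 0 < t2 < T -> M t1 = M t2.
Proof.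
wlog le12 : t1 t2 / t1 <= t2.
  by have [|/ltW] := leP t1 t2 => le12 H h1 h2; [|apply/esym]; exact: H.
move=> /andP[t10 _] /andP[_ t2T].
have tT t : t \in `[t1, t2]%R -> 0 < t < T.
  rewrite in_itv/= => /andP[a b]; apply/andP; split.
    exact: lt_le_trans a.
  exact: le_lt_trans t2T.
have [|||c _] := @MVT_segment R M (fun=> 0) t1 t2.
- by [].
- by move=> t /subset_itv_oo_cc /tT; exact: dM.
- by apply: derivable_within_continuous => t /tT tt; case: (dM tt).
by rewrite mul0r => /subr0_eq.
Qed.

(** The circular mean is constant and tends to [P 0] at small radii, while the defect [P 0 - P] is
    continuous and nonnegative; so the defect vanishes. The conclusion is stated at angle 0, and
    [max_disc] reaches the other points by a rotation. *)
Lemma mean_max : {for 0, continuous P} ->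
  (forall z, 0 < nsq z < T ^+ 2 -> P z <= P 0) ->
  forall t, 0 < t < T -> P (t, 0) = P 0.
Proof.
move=> cP Pmax t tT; apply/eqP; rewrite eq_le; apply/andP; split.
  apply: Pmax; have := gV 0 tT; rewrite /g cos0 sin0 mulr1 mulr0; exact.
rewrite leNgt; apply/negP => Pt.
have mI : measurable (I : set (measurableTypeR R)) by exact: measurable_itv.
set m := fine (mu I).
have m0 : 0 <= m by apply: fine_ge0.
have intc (k : R) : mu.-integrable I (EFin \o (fun _ : R => k)).
  apply: continuous_compact_integrable; first exact: segment_compact.
  by apply: continuous_subspaceT; exact: cst_continuous.
(* The integral over the circle of radius [t] equals that over an arbitrarily small circle, where
   [P] is close to [P 0] by continuity. *)
have lbM e : 0 < e -> (P 0 - e) * m <= M t.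
  move=> e0; move/cvgrPdist_le : cP => /(_ e e0)/nbhs_ballP[d /= d0 Hd].
  pose r := Num.min (d / 2) (t / 2).
  have /andP[t0 t1] := tT.
  have r0 : 0 < r by rewrite lt_min !divr_gt0.
  have rd : r < d by rewrite gt_min; apply/orP; left; lra.
  have rT : 0 < r < T by rewrite r0 /= gt_min; apply/orP; right; lra.
  rewrite (M_const tT rT) -Rintegral_cst//; apply: le_Rintegral => //.
    exact: intP.
  move=> s _; have bs : ball (0 : R * R) d (g r s).
    have rle (x : R) : `|x| <= 1 -> `|0 - r * x| < d.
      by move=> x1; rewrite sub0r normrN normrM (gtr0_norm r0)
        (le_lt_trans _ rd)// ler_piMr// ltW.
    split; apply: rle; rewrite ler_norml.
      by rewrite cos_geN1 cos_le1.
    by rewrite sin_geN1 sin_le1.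
  by have := Hd _ bs; rewrite /= ler_norml => /andP[_]; lra.
have {}lbM : P 0 * m <= M t.
  apply/ler_addgt0Pr => e e0.
  have m10 : 0 < m + 1 by rewrite ltr_wpDl.
  have := lbM (e / (m + 1)) (divr_gt0 e0 m10).
  have : e / (m + 1) * m <= e by rewrite mulrAC ler_pdivrMr// ler_pM2l//; lra.
  by nra.
pose F s := P 0 - P (g t s).
have F0 s : 0 <= F s by rewrite subr_ge0 Pmax//; exact: (gV s tT).
have cPg : continuous (fun s => P (g t s)).
  by move=> s; apply/differentiable_continuous/derivable1_diffP; exact: dsP.
have cF : continuous F by move=> s; apply: cvgB; [exact: cvg_cst|exact: cPg].
have iF : \int[mu]_(s in I) F s <= 0.
  rewrite /F RintegralB//; last exact: intP.
  by rewrite Rintegral_cst// subr_le0.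
have F00 : 0 < F 0.
  by rewrite subr_gt0 /g cos0 sin0 mulr1 mulr0.
(* On a short arc around angle 0 the defect is at least half of [F 0], so its integral would be
   positive. *)
have F20 : 0 < F 0 / 2 by rewrite divr_gt0.
have /cvgrPdist_le /(_ _ F20)/nbhs_ballP[d /= d0 Hd] := cF 0.
pose r := Num.min (d / 2) pi.
have r0 : 0 < r by rewrite lt_min divr_gt0//= pi_gt0.
have rd : r < d by rewrite gt_min; apply/orP; left; lra.
have rpi : r <= pi by rewrite ge_min lexx orbT.
pose J : set R := `[- r, r]%classic.
have JI : J `<=` I.
  by apply: subset_itvScc; rewrite bnd_simp ?lerN2.
have mJ : measurable (J : set (measurableTypeR R)) by exact: measurable_itv.
have intF : mu.-integrable I (EFin \o F).
  apply: continuous_compact_integrable; first exact: segment_compact.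
  exact: continuous_subspaceT.
have /integrableP[mF _] := intF.
have := iF; rewrite leNgt => /negP; apply; rewrite fine_gt0//.
rewrite ltey_eq (integrable_fin_num mI intF) andbT.
apply: (@lt_le_trans _ _ (\int[mu]_(s in J) (F s)%:E)%E); last first.
  by apply: ge0_subset_integral => // s _; rewrite lee_fin.
apply: (@lt_le_trans _ _ (\int[mu]_(s in J) cst (F 0 / 2)%:E s)%E).
  rewrite integral_cst//.
  have muJ : mu J = (r + r)%:E.
    by rewrite /mu /J lebesgue_measure_itv/= lte_fin gtrN// -EFinD opprK.
  by rewrite -[X in (_ * X)%E]/(mu J) muJ -EFinM lte_fin mulr_gt0// addr_gt0.
apply: ge0_le_integral => //.
- by move=> s _; rewrite lee_fin ltW.
- exact: measurable_funS mF.
- move=> s; rewrite /J /= in_itv/= => /andP[s1 s2]; rewrite lee_fin.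
  have : ball (0 : R) d s.
    by rewrite /ball/= sub0r normrN ltr_norml; apply/andP; split; lra.
  by move/Hd; rewrite /= ler_norml => /andP[_]; lra.
Qed.

End Circles.
End MeanValue.

(** * Holomorphic pairs *)

Section HolomorphicCalculus.
Variable R : realType.
Implicit Types (P Q A B f g : R * R -> R) (z w c m : R * R) (U : set (R * R)).
Implicit Types (a b k s t : R).

Lemma is_diff_lin2_affine z k a b : is_diff z (fun w => k + lin2 a b w) (lin2 a b).
Proof.
apply/is_diff_lin2P => e e0; near=> w.
have -> : k + lin2 a b w - (k + lin2 a b z) - lin2 a b (w - z) = 0.
  by rewrite /lin2 /=; ring.
by rewrite normr0 mulr_ge0// ltW.
Unshelve. all: by end_near. Qed.

Lemma is_diff_lin2_cst z k : is_diff z (fun=> k) (lin2 0 0).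
Proof.
have := is_diff_lin2_affine z k 0 0; congr (is_diff _ _ _).
by apply/funext => w; rewrite /lin2 !mul0r !addr0.
Qed.

Lemma is_diff_lin2_fst z : is_diff z (fun w => w.1) (lin2 1 0).
Proof.
have := is_diff_lin2_affine z 0 1 0; congr (is_diff _ _ _).
by apply/funext => w; rewrite /lin2 mul0r mul1r addr0 add0r.
Qed.

Lemma is_diff_lin2_snd z : is_diff z (fun w => w.2) (lin2 0 1).
Proof.
have := is_diff_lin2_affine z 0 0 1; congr (is_diff _ _ _).
by apply/funext => w; rewrite /lin2 mul0r mul1r !add0r.
Qed.

Lemma is_diff_lin2D z f g (a1 b1 a2 b2 : R) :
  is_diff z f (lin2 a1 b1) -> is_diff z g (lin2 a2 b2) ->
  is_diff z (fun w => f w + g w) (lin2 (a1 + a2) (b1 + b2)).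
Proof.
move=> df dg; apply: (is_diff_eq (is_diffD df dg)).
by apply/funext => v; rewrite /lin2 /= ?fctE; ring.
Qed.

Lemma is_diff_lin2N z f a b :
  is_diff z f (lin2 a b) -> is_diff z (fun w => - f w) (lin2 (- a) (- b)).
Proof.
move=> df; apply: (is_diff_eq (is_diffN df)).
by apply/funext => v; rewrite /lin2 /= ?fctE; ring.
Qed.

Lemma is_diff_lin2B z f g (a1 b1 a2 b2 : R) :
  is_diff z f (lin2 a1 b1) -> is_diff z g (lin2 a2 b2) ->
  is_diff z (fun w => f w - g w) (lin2 (a1 - a2) (b1 - b2)).
Proof. by move=> df /is_diff_lin2N; exact: is_diff_lin2D. Qed.

Lemma is_diff_lin2M z f g (a1 b1 a2 b2 : R) :
  is_diff z f (lin2 a1 b1) -> is_diff z g (lin2 a2 b2) ->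
  is_diff z (fun w => f w * g w)
    (lin2 (f z * a2 + g z * a1) (f z * b2 + g z * b1)).
Proof.
move=> df dg; apply: (is_diff_eq (is_diffM df dg)).
by apply/funext => v; rewrite /lin2 /= ?fctE /GRing.scale /=; ring.
Qed.

Lemma is_diff_lin2V z f a b : f z != 0 -> is_diff z f (lin2 a b) ->
  is_diff z (fun w => (f w)^-1) (lin2 (- (a / f z ^+ 2)) (- (b / f z ^+ 2))).
Proof.
move=> fz df; have dfz : differentiable f z by exact: ex_diff.
apply: DiffDef; first exact: differentiableV.
rewrite diffV// diff_val; apply/funext => v.
by rewrite /lin2 /= ?fctE /GRing.scale /=; field.
Qed.

Lemma holo_continuous U P Q A B z : holo U P Q A B -> U z ->
  {for z, continuous P} /\ {for z, continuous Q}.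
Proof.
by move=> h /h[dP dQ _ _]; split; apply: differentiable_continuous; exact: ex_diff.
Qed.

Lemma holoN U P Q A B : holo U P Q A B ->
  holo U (fun z => - P z) (fun z => - Q z) (fun z => - A z) (fun z => - B z).
Proof.
move=> h z /h[dP dQ cA cB]; split.
- exact: is_diff_lin2N.
- exact: is_diff_lin2N.
- exact: cvgN.
- exact: cvgN.
Qed.

Lemma holoD U P1 Q1 A1 B1 P2 Q2 A2 B2 :
  holo U P1 Q1 A1 B1 -> holo U P2 Q2 A2 B2 ->
  holo U (fun z => P1 z + P2 z) (fun z => Q1 z + Q2 z)
         (fun z => A1 z + A2 z) (fun z => B1 z + B2 z).
Proof.
move=> h1 h2 z Uz; have [dP1 dQ1 cA1 cB1] := h1 z Uz.
have [dP2 dQ2 cA2 cB2] := h2 z Uz; split.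
- by rewrite opprD; exact: is_diff_lin2D.
- exact: is_diff_lin2D.
- exact: cvgD.
- exact: cvgD.
Qed.

Lemma holoM U P1 Q1 A1 B1 P2 Q2 A2 B2 :
  holo U P1 Q1 A1 B1 -> holo U P2 Q2 A2 B2 ->
  holo U (fun z => P1 z * P2 z - Q1 z * Q2 z) (fun z => P1 z * Q2 z + Q1 z * P2 z)
    (fun z => P1 z * A2 z - Q1 z * B2 z + (P2 z * A1 z - Q2 z * B1 z))
    (fun z => P1 z * B2 z + Q1 z * A2 z + (P2 z * B1 z + Q2 z * A1 z)).
Proof.
move=> h1 h2 z Uz; have [dP1 dQ1 cA1 cB1] := h1 z Uz.
have [dP2 dQ2 cA2 cB2] := h2 z Uz.
have [cP1 cQ1] := holo_continuous h1 Uz; have [cP2 cQ2] := holo_continuous h2 Uz.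
split.
- apply: (is_diff_eq (is_diff_lin2B (is_diff_lin2M dP1 dP2) (is_diff_lin2M dQ1 dQ2))).
  by congr (lin2 _ _); ring.
- apply: (is_diff_eq (is_diff_lin2D (is_diff_lin2M dP1 dQ2) (is_diff_lin2M dQ1 dP2))).
  by congr (lin2 _ _); ring.
- by apply: cvgD; [apply: cvgB|apply: cvgB]; exact: cvgM.
- by apply: cvgD; apply: cvgD; exact: cvgM.
Qed.

Lemma holo_cst U k s : holo U (fun=> k) (fun=> s) (fun=> 0) (fun=> 0).
Proof.
move=> z _; split; rewrite ?oppr0.
- exact: is_diff_lin2_cst.
- exact: is_diff_lin2_cst.
- exact: cvg_cst.
- exact: cvg_cst.
Qed.

Lemma nsq_continuous : continuous (@nsq R).
Proof.
by move=> z; apply: cvgD; apply: cvgM; solve [exact: cvg_fst | exact: cvg_snd].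
Qed.

(** The pair is [1 / z], with derivative [- 1 / z ^+ 2]. *)
Lemma holo_inv : holo [set z | nsq z != 0] (fun z => z.1 / nsq z)
  (fun z => - (z.2 / nsq z)) (fun z => (z.2 ^+ 2 - z.1 ^+ 2) / nsq z ^+ 2)
  (fun z => 2 * z.1 * z.2 / nsq z ^+ 2).
Proof.
move=> z /= nz.
have dn : is_diff z (@nsq R) (lin2 (2 * z.1) (2 * z.2)).
  apply: (is_diff_eq (is_diff_lin2D
    (is_diff_lin2M (is_diff_lin2_fst z) (is_diff_lin2_fst z))
    (is_diff_lin2M (is_diff_lin2_snd z) (is_diff_lin2_snd z)))).
  by congr (lin2 _ _); ring.
have dV := is_diff_lin2V nz dn.
have c1 : {for z, continuous (@fst R R)} by exact: cvg_fst.
have c2 : {for z, continuous (@snd R R)} by exact: cvg_snd.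
have cV : {for z, continuous (fun w => (nsq w ^+ 2)^-1)}.
  apply: cvgV; first by rewrite expf_neq0.
  by apply: cvgM; exact: nsq_continuous.
split.
- apply: (is_diff_eq (is_diff_lin2M (is_diff_lin2_fst z) dV)).
  by move: nz; rewrite /nsq => nz; congr (lin2 _ _); field.
- apply: (is_diff_eq (is_diff_lin2N (is_diff_lin2M (is_diff_lin2_snd z) dV))).
  by move: nz; rewrite /nsq => nz; congr (lin2 _ _); field.
- by apply: cvgM => //; apply: cvgB; exact: cvgM.
- by apply: cvgM => //; apply: cvgM => //; apply: cvgM => //; exact: cvg_cst.
Qed.

(* The map zeta |-> c + m zeta of the complex plane. *)
Definition caffine c m w : R * R :=
  (c.1 + lin2 m.1 (- m.2) w, c.2 + lin2 m.2 m.1 w).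

Lemma nsq_ge0 z : 0 <= nsq z.
Proof. by rewrite addr_ge0// sqr_ge0. Qed.

Lemma nsq_eq0 z : (nsq z == 0) = (z == 0).
Proof. by rewrite paddr_eq0 ?sqr_ge0// !sqrf_eq0; case: z. Qed.

Lemma nsq_gt0 z : (0 < nsq z) = (z != 0).
Proof. by rewrite lt_def nsq_ge0 andbT nsq_eq0. Qed.

Lemma nsq0 : nsq (0 : R * R) = 0.
Proof. by apply/eqP; rewrite nsq_eq0. Qed.

Lemma nsq_caffineB c m w : nsq (caffine c m w - c) = nsq m * nsq w.
Proof. by rewrite /nsq /caffine /lin2 /=; ring. Qed.

Lemma nsq_caffine0 m w : nsq (caffine 0 m w) = nsq m * nsq w.
Proof. by rewrite -(nsq_caffineB 0) subr0. Qed.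

Lemma caffine0 c m : caffine c m 0 = c.
Proof. by rewrite /caffine /lin2 /= !mulr0 !addr0 -surjective_pairing. Qed.

Lemma is_diff_caffine c m w :
  is_diff w (caffine c m) (fun v => (lin2 m.1 (- m.2) v, lin2 m.2 m.1 v)).
Proof. by apply: is_diff_pair; exact: is_diff_lin2_affine. Qed.

Lemma caffine_continuous c m : continuous (caffine c m).
Proof.
move=> w; apply: differentiable_continuous.
by have [] := is_diff_caffine c m w.
Qed.

Lemma holo_caffine U P Q A B c m : holo U P Q A B ->
  holo (caffine c m @^-1` U) (P \o caffine c m) (Q \o caffine c m)
    (fun w => A (caffine c m w) * m.1 - B (caffine c m w) * m.2)
    (fun w => A (caffine c m w) * m.2 + B (caffine c m w) * m.1).
Proof.
move=> h w /= /h[dP dQ cA cB].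
have dc := is_diff_caffine c m w.
have cc := @caffine_continuous c m w.
have cA' := @continuous_comp _ _ _ _ A _ cc cA.
have cB' := @continuous_comp _ _ _ _ B _ cc cB.
split.
- apply: (is_diff_eq (is_diff_comp dc dP)).
  by apply/funext => v; rewrite /lin2 /=; ring.
- apply: (is_diff_eq (is_diff_comp dc dQ)).
  by apply/funext => v; rewrite /lin2 /=; ring.
- by apply: cvgB; apply: cvgM => //; exact: cvg_cst.
- by apply: cvgD; apply: cvgM => //; exact: cvg_cst.
Qed.

End HolomorphicCalculus.

(** * The maximum principle *)

Section MaximumPrinciple.
Variable R : realType.
Implicit Types (P Q A B f g : R * R -> R) (z w c m : R * R) (U : set (R * R)).
Implicit Types (a b k s t K M : R).

Lemma norm_fst_le_nsq z r : 0 <= r -> nsq z <= r ^+ 2 -> `|z.1| <= r.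
Proof.
move=> r0 zr; rewrite -(@ler_pXn2r _ 2)// real_normK ?num_real//.
by apply: le_trans zr; rewrite lerDl sqr_ge0.
Qed.

Lemma norm_snd_le_nsq z r : 0 <= r -> nsq z <= r ^+ 2 -> `|z.2| <= r.
Proof.
move=> r0 zr; rewrite -(@ler_pXn2r _ 2)// real_normK ?num_real//.
by apply: le_trans zr; rewrite lerDr sqr_ge0.
Qed.

(** The similarity [zeta |-> c + (z - c) zeta] sends 0 to [c] and 1 to [z], and pulls the disc back
    to one of radius [T > 1]; there [mean_max] applies. *)
Lemma max_disc P Q A B c s : 0 < s ->
  holo [set z | 0 < nsq (z - c) < s ^+ 2] P Q A B -> {for c, continuous P} ->
  (forall z, nsq (z - c) < s ^+ 2 -> P z <= P c) ->
  forall z, nsq (z - c) < s ^+ 2 -> P z = P c.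
Proof.
move=> s0 h cP Pmax z zs; have [->//|zc] := eqVneq z c.
pose m := z - c; have m0 : 0 < nsq m by rewrite nsq_gt0 subr_eq0.
have sm0 : 0 < Num.sqrt (nsq m) by rewrite sqrtr_gt0.
have smE : Num.sqrt (nsq m) ^+ 2 = nsq m by rewrite sqr_sqrtr// ltW.
pose T := s / Num.sqrt (nsq m).
have T2 : T ^+ 2 = s ^+ 2 / nsq m by rewrite expr_div_n smE.
have zE : caffine c m (1, 0) = z.
  by rewrite /caffine /lin2 /m /= !mulr1 !mulr0 !addr0 !subrKC -surjective_pairing.
have sub : [set w | 0 < nsq w < T ^+ 2] `<=`
    caffine c m @^-1` [set z | 0 < nsq (z - c) < s ^+ 2].
  move=> w /= /andP[w0 wT].
  by rewrite nsq_caffineB mulr_gt0//= mulrC -ltr_pdivlMr// -T2.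
have h' := holo_sub sub (holo_caffine (c := c) (m := m) h).
have := mean_max h' _ _ (t := 1); rewrite /= caffine0 zE; apply.
- have c0 := caffine0 c m.
  apply: (@continuous_comp _ _ _ _ P); last by rewrite caffine0.
  exact: caffine_continuous.
- move=> w /andP[_ wT]; apply: Pmax.
  by rewrite nsq_caffineB mulrC -ltr_pdivlMr// -T2.
- rewrite ltr01 /= /T ltr_pdivlMr// mul1r.
  by rewrite -(@ltr_pXn2r _ 2)// ?nnegrE ?ltW// smE.
Qed.

(** Once [P 0 = K], [max_disc] about 0 covers the whole disc. The maximum is carried from [z0] to 0
    along the segment: if the infimum [t0] of the parameters attaining it were positive, a small
    disc about [y t0] avoiding 0 would yield a smaller parameter. *)
Lemma max_disc_global P Q A B K z0 :
  holo [set z | 0 < nsq z < 1] P Q A B -> {for 0, continuous P} ->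
  (forall z, nsq z < 1 -> P z <= K) -> nsq z0 < 1 -> P z0 = K ->
  forall z, nsq z < 1 -> P z = K.
Proof.
move=> h cP Pmax z01 Pz0.
suff P0 : P 0 = K.
  move=> z z1; rewrite -P0; apply: (@max_disc P Q A B 0 1) => //.
  - by apply: holo_sub h => w /=; rewrite subr0 expr1n.
  - by move=> w; rewrite subr0 expr1n P0; exact: Pmax.
  - by rewrite subr0 expr1n.
have [z00|z00] := eqVneq z0 0; first by rewrite -z00.
pose y t := (t * z0.1, t * z0.2).
have y0 : y 0 = 0 by rewrite /y !mul0r.
have y1 : y 1 = z0 by rewrite /y !mul1r -surjective_pairing.
have nsqy t : nsq (y t) = t ^+ 2 * nsq z0 by rewrite /nsq /=; ring.
have nsqyB t t' : nsq (y t - y t') = (t - t') ^+ 2 * nsq z0 by rewrite /nsq /=; ring.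
have nz0 : 0 < nsq z0 by rewrite nsq_gt0.
have y_lt1 t : 0 <= t <= 1 -> nsq (y t) < 1.
  move=> /andP[t0 t1]; rewrite nsqy (le_lt_trans _ z01)// ler_piMl ?nsq_ge0//.
  by rewrite expr_le1.
have cPy t : 0 <= t <= 1 -> {for y t, continuous P}.
  have [->|t0] := eqVneq t 0; first by rewrite y0.
  move=> t01; have [] // := holo_continuous h (z := y t).
  by rewrite /= y_lt1// nsqy mulr_gt0// exprn_even_gt0.
have cy : continuous y.
  move=> t; refine (@continuous_pair R R (fun t => t * z0.1)
    (fun t => t * z0.2) t _ _); apply: cvgM; solve [exact: cvg_id|exact: cvg_cst].
pose S := [set t : R | 0 <= t <= 1 /\ P (y t) = K].
have S1 : S 1 by split; rewrite ?ler01 ?lexx// y1.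
have infS : has_inf S by split; [exists 1|exists 0 => t [/andP[]]].
have t00 : 0 <= inf S by apply: lb_le_inf; [exists 1|move=> t [/andP[]]].
have t01 : inf S <= 1 by apply: ge_inf => //; case: infS.
set t0 := inf S in t00 t01.
have t0i : 0 <= t0 <= 1 by rewrite t00.
have PK : P (y t0) = K.
  apply/eqP; rewrite eq_le Pmax ?y_lt1//= leNgt; apply/negP => PK.
  have cc : {for t0, continuous (P \o y)}.
    by apply: (@continuous_comp _ _ _ _ P); [exact: cy|exact: cPy].
  have e0 : 0 < (K - P (y t0)) / 2 by rewrite divr_gt0// subr_gt0.
  have /cvgrPdist_le /(_ _ e0)/nbhs_ballP[d /= d0 Hd] := cc.
  have [t [ti Pt] tt0] := inf_adherent d0 infS.
  have t0t : t0 <= t by apply: ge_inf; [case: infS|].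
  have : ball t0 d t.
    by rewrite /ball/= distrC ger0_norm ?subr_ge0//; rewrite -/t0 in tt0; lra.
  by move/Hd; rewrite /= Pt ler_norml => /andP[]; lra.
have [t0E|t0n] := eqVneq t0 0; first by rewrite -y0 -t0E.
have t0p : 0 < t0 by rewrite lt_def t0n.
have n0 : 0 < nsq (y t0) < 1 by rewrite y_lt1// nsqy mulr_gt0// exprn_gt0.
have [d d0 Hd] : exists2 d, 0 < d & forall z, nsq (z - y t0) < d ^+ 2 -> 0 < nsq z < 1.
  have := @nsq_continuous R (y t0).
  pose e := Num.min (nsq (y t0)) (1 - nsq (y t0)).
  have /andP[n1 n2] := n0.
  have e0 : 0 < e by rewrite lt_min n1 subr_gt0.
  move=> /cvgrPdist_lt/(_ _ e0)/nbhs_ballP[d /= d0 Hd].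
  exists (d / 2) => [|z /ltW zd]; first by rewrite divr_gt0.
  have d20 : 0 <= d / 2 by rewrite divr_ge0// ltW.
  have : ball (y t0) d z.
    have d2 : d / 2 < d by rewrite ltr_pdivrMr// ltr_pMr// ltr1n.
    split; rewrite /ball/= distrC (le_lt_trans _ d2)//.
      exact: (norm_fst_le_nsq d20 zd).
    exact: (norm_snd_le_nsq d20 zd).
  move/Hd; rewrite ltr_norml => /andP[].
  have : e <= nsq (y t0) by rewrite ge_min lexx.
  have : e <= 1 - nsq (y t0) by rewrite ge_min lexx orbT.
  by move=> *; apply/andP; split; lra.
(* Going back by at most [d / 2] stays in the disc of radius [d] about [y t0], since [nsq z0 < 1];
   the minimum with [t0] keeps the parameter nonnegative. *)
pose t1 := t0 - Num.min t0 (d / 2).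
have d20 : 0 < d / 2 by rewrite divr_gt0.
have m0 : 0 < Num.min t0 (d / 2) by rewrite lt_min t0p.
have mt : Num.min t0 (d / 2) <= t0 by rewrite ge_min lexx.
have md : Num.min t0 (d / 2) <= d / 2 by rewrite ge_min lexx orbT.
have : t0 <= t1.
  apply: ge_inf; first by case: infS.
  split; first by rewrite /t1; apply/andP; split; lra.
  rewrite -PK; apply: (@max_disc P Q A B (y t0) d) => //.
  - by apply: holo_sub h => z /= /andP[_]; exact: Hd.
  - exact: cPy.
  - by move=> z /Hd/andP[_]; rewrite PK; exact: Pmax.
  - by rewrite nsqyB /t1; move: m0 md z01 nz0; set m := Num.min _ _ => *; nra.
by rewrite /t1; lra.
Qed.

Lemma disc_compact r : 0 <= r -> compact [set z : R * R | nsq z <= r ^+ 2].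
Proof.
move=> r0; apply: (@subclosed_compact _ _ (`[- r, r] `*` `[- r, r])).
- rewrite (_ : [set z | _] = @nsq R @^-1` [set x | x <= r ^+ 2]) //.
  by apply: closed_comp; [move=> *; exact: nsq_continuous|exact: closed_le].
- by apply: compact_setX; exact: segment_compact.
- move=> z /= zr; split; rewrite /= in_itv /= -ler_norml.
    exact: norm_fst_le_nsq.
  exact: norm_snd_le_nsq.
Qed.

(** The maximum over the closed disc is attained at some [w]. If [w] is interior, [P] is constant on
    the open disc, and by continuity takes the same value at the boundary point [(r, 0)]. *)
Lemma max_circle P Q A B K r : 0 < r < 1 ->
  holo [set z | 0 < nsq z < 1] P Q A B -> {for 0, continuous P} ->
  (forall z, nsq z = r ^+ 2 -> P z <= K) ->
  forall z, nsq z <= r ^+ 2 -> P z <= K.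
Proof.
move=> /andP[r0 r1] h cP Pbd z zr.
have r21 : r ^+ 2 < 1 by rewrite expr_lt1// ltW.
have cPz w : nsq w < 1 -> {for w, continuous P}.
  have [->//|w0 w1] := eqVneq w 0.
  by have [] // := holo_continuous h (z := w); rewrite /= w1 nsq_gt0 w0.
pose D := [set z : R * R | nsq z <= r ^+ 2].
have [w Dw wmax] : exists2 w, w \in D & forall v, v \in D -> P v <= P w.
  apply: compact_EVT_max; [by exists z|exact: disc_compact (ltW r0)|].
  apply/continuous_in_subspaceT => w; rewrite inE => Dw.
  by apply: cPz; exact: le_lt_trans r21.
apply: le_trans (wmax z _) _; first by rewrite inE.
move: Dw; rewrite inE /D /= le_eqVlt => /orP[/eqP|wr]; first exact: Pbd.
have nr : nsq (r, 0 : R) = r ^+ 2 by rewrite /nsq /= expr0n addr0.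
have sub : [set w | 0 < nsq w < 1] `<=`
    caffine 0 (r, 0) @^-1` [set z | 0 < nsq z < 1].
  move=> v /= /andP[v0 v1].
  by rewrite nsq_caffine0 nr mulr_gt0 ?exprn_gt0//=; nra.
have h' := holo_sub sub (holo_caffine (c := 0) (m := (r, 0)) h).
have c0 := caffine0 0 (r, 0 : R).
have wE : caffine 0 (r, 0) (w.1 / r, w.2 / r) = w.
  rewrite /caffine /lin2 /= !mul0r oppr0 mul0r !add0r !addr0 ![r * _]mulrC.
  by rewrite !divfK ?gt_eqF// -surjective_pairing.
have := @max_disc_global _ _ _ _ (P w) (w.1 / r, w.2 / r) h'.
rewrite /= wE => H.
have {}H v : nsq v < 1 -> P (caffine 0 (r, 0) v) = P w.
  apply: H => //.
  - apply: (@continuous_comp _ _ _ _ P); last by rewrite caffine0.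
    exact: caffine_continuous.
  - move=> v' v'1; apply: wmax; rewrite inE /D /= nsq_caffine0 nr.
    by rewrite ler_piMr ?sqr_ge0// ltW.
  - rewrite (_ : nsq _ = nsq w / r ^+ 2); last first.
      by rewrite /nsq /=; field; rewrite gt_eqF.
    by rewrite ltr_pdivrMr ?exprn_gt0// mul1r.
have cPr : {for (r, 0 : R), continuous P} by apply: cPz; rewrite nr.
have rE t : caffine 0 (r, 0) (t, 0) = (r * t, 0).
  by rewrite /caffine /lin2 /=; congr pair; ring.
suff -> : P w = P (r, 0) by exact: Pbd.
apply/eqP; rewrite eq_le wmax ?inE /D /= ?nr// andbT.
apply/ler_addgt0Pr => e e0.
move/cvgrPdist_le : cPr => /(_ e e0)/nbhs_ballP[d /= d0 Hd].
(* The point [(r * t, 0)] is inside the disc and within [d] of [(r, 0)]; the maximum with 0 keeps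
   [t] nonnegative. *)
pose t := Num.max 0 (1 - d / 2).
have t1 : t < 1 by rewrite gt_max ltr01 /=; lra.
have t0 : 0 <= t by rewrite le_max lexx.
have td : 1 - d / 2 <= t by rewrite le_max lexx orbT.
rewrite -(H (t, 0)) ?rE; last by rewrite /nsq /= expr0n addr0 expr_lt1.
have : ball (r, 0 : R) d (r * t, 0).
  split; rewrite /ball/= ?subrr ?normr0//.
  by rewrite ger0_norm; nra.
by move/Hd; rewrite /= ler_norml => /andP[]; lra.
Qed.

End MaximumPrinciple.

(** * The Schwarz lemma *)

Section Schwarz.
Variable R : realType.
Implicit Types (P Q A B f g : R * R -> R) (z w c m : R * R) (U : set (R * R)).
Implicit Types (a b k r s t K M : R).

Lemma is_diff_lin2_near f g z a b :
  (\forall w \near z, f w = g w) -> is_diff z f (lin2 a b) -> is_diff z g (lin2 a b).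
Proof.
move=> fg /is_diff_lin2P df; apply/is_diff_lin2P => e e0.
have fgz := nbhs_singleton fg.
by apply: filterS2 fg (df e e0) => w <-; rewrite fgz.
Qed.

Lemma holo_near U P Q A B P' Q' A' B' :
  (forall z, U z -> \forall w \near z,
    [/\ P w = P' w, Q w = Q' w, A w = A' w & B w = B' w]) ->
  holo U P Q A B -> holo U P' Q' A' B'.
Proof.
move=> E h z Uz; have [dP dQ cA cB] := h z Uz.
have nE := E z Uz; have [_ _ Az Bz] := nbhs_singleton nE.
rewrite -Az -Bz; split.
- by apply: is_diff_lin2_near dP; apply: filterS nE => w [].
- by apply: is_diff_lin2_near dQ; apply: filterS nE => w [].
- have nA : \forall w \near z, A w = A' w by apply: filterS nE => w [].
  have : A' w @[w --> z] --> A z by apply: cvg_trans cA; exact: near_eq_cvg.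
  by rewrite Az.
- have nB : \forall w \near z, B w = B' w by apply: filterS nE => w [].
  have : B' w @[w --> z] --> B z by apply: cvg_trans cB; exact: near_eq_cvg.
  by rewrite Bz.
Qed.

Lemma open_disc r : open [set z : R * R | nsq z < r].
Proof.
rewrite (_ : [set z | _] = @nsq R @^-1` [set x | x < r]) //.
by apply: open_comp; [move=> *; exact: nsq_continuous|exact: open_lt].
Qed.

Lemma open_punctured_disc r : open [set z : R * R | 0 < nsq z < r].
Proof.
rewrite (_ : [set z | _] = @nsq R @^-1` [set x | 0 < x] `&` [set z | nsq z < r]).
  apply: openI; last exact: open_disc.
  by apply: open_comp; [move=> *; exact: nsq_continuous|exact: open_gt].
by apply/seteqP; split => z /=; [move=> /andP[]|move=> [-> ->]].
Qed.

Lemma normr_sqr_le_nsq z : `|z| ^+ 2 <= nsq z.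
Proof.
rewrite prod_normE /= /Num.max; case: ifP => _.
  by rewrite real_normK ?num_real// lerDr sqr_ge0.
by rewrite real_normK ?num_real// lerDl sqr_ge0.
Qed.

Lemma cauchy_schwarz2 a b k s : (a * k + b * s) ^+ 2 <= (a ^+ 2 + b ^+ 2) * (k ^+ 2 + s ^+ 2).
Proof.
rewrite -subr_ge0; have -> : (a ^+ 2 + b ^+ 2) * (k ^+ 2 + s ^+ 2) - (a * k + b * s) ^+ 2
  = (a * s - b * k) ^+ 2 by ring.
exact: sqr_ge0.
Qed.

(* [xP + yQ] is [|z|^2] times the real part of [(P + iQ) / z]. *)
Lemma schwarz P Q A B M : 0 <= M -> holo [set z | nsq z < 1] P Q A B ->
  P 0 = 0 -> Q 0 = 0 -> (forall z, nsq z < 1 -> P z ^+ 2 + Q z ^+ 2 <= M ^+ 2) ->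
  [/\ forall z, nsq z < 1 -> z.1 * P z + z.2 * Q z <= M * nsq z, A 0 <= M &
      A 0 = M \/ (exists z, [/\ nsq z < 1, z != 0 & z.1 * P z + z.2 * Q z = M * nsq z]) ->
      A 0 = M /\ forall z, nsq z < 1 -> z.1 * P z + z.2 * Q z = M * nsq z].
Proof.
move=> M0 h P0 Q0 bnd.
(* The value at 0 is the limit of the quotient, the real part of the derivative. *)
pose p z := if z == 0 then A 0 else (z.1 * P z + z.2 * Q z) / nsq z.
have p0 : p 0 = A 0 by rewrite /p eqxx.
have pE z : z.1 * P z + z.2 * Q z = p z * nsq z.
  rewrite /p; case: eqVneq => [->|z0]; first by rewrite nsq0 !mul0r mulr0 addr0.
  by rewrite divfK// gt_eqF// nsq_gt0.
have [Q' [A' [B' hp]]] : exists Q' A' B', holo [set z | 0 < nsq z < 1] p Q' A' B'.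
  have s1 : [set z : R * R | 0 < nsq z < 1] `<=` [set z | nsq z < 1].
    by move=> z /andP[].
  have s2 : [set z : R * R | 0 < nsq z < 1] `<=` [set z | nsq z != 0].
    by move=> z /andP[/gt_eqF /= ->].
  have := holoM (holo_sub s1 h) (holo_sub s2 (@holo_inv R)).
  move=> /(@holo_near _ _ _ _ _ p) H; do 3 eexists; apply: H => z Uz.
  have := open_nbhs_nbhs (conj (@open_punctured_disc 1) Uz).
  apply: filterS => w /= /andP[w0 _]; split; [|reflexivity..].
  by rewrite /p; move: w0; rewrite nsq_gt0 => /negbTE ->; ring.
have cp : {for 0, continuous p}.
  have n01 : nsq (0 : R * R) < 1 by rewrite nsq0.
  have [/is_diff_lin2P dP /is_diff_lin2P dQ _ _] := h 0 n01.
  apply/cvgrPdist_le => /= e e0; have e20 : 0 < e / 2 by rewrite divr_gt0.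
  apply: filterS2 (dP _ e20) (dQ _ e20) => w.
  rewrite P0 Q0 !subr0 p0 /p; case: eqVneq => [_ _ _|w0].
    by rewrite subrr normr0 ltW.
  have n0 : 0 < nsq w by rewrite nsq_gt0.
  move=> h1 h2.
  (* The linear parts contribute exactly [A 0], the terms in [B 0] cancelling; only the remainders
     are left. *)
  have -> : A 0 - (w.1 * P w + w.2 * Q w) / nsq w =
    - (w.1 * (P w - lin2 (A 0) (- B 0) w) + w.2 * (Q w - lin2 (B 0) (A 0) w)) / nsq w.
    by move: (n0); rewrite /nsq /lin2 => /gt_eqF n0'; field; rewrite n0'.
  rewrite mulNr normrN normrM normfV (gtr0_norm n0) ler_pdivrMr//.
  rewrite (le_trans (ler_normD _ _))// !normrM.
  have w1 : `|w.1| <= `|w| by rewrite prod_normE /= le_max lexx.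
  have w2 : `|w.2| <= `|w| by rewrite prod_normE /= le_max lexx orbT.
  have := lerD (ler_pM (normr_ge0 _) (normr_ge0 _) w1 h1)
               (ler_pM (normr_ge0 _) (normr_ge0 _) w2 h2).
  move=> /le_trans; apply; rewrite -mulrDr -mulrDl -splitr mulrCA -expr2.
  by rewrite ler_pM2l// normr_sqr_le_nsq.
have pM z : nsq z < 1 -> p z <= M.
  (* On the circle of radius [r], Cauchy-Schwarz bounds the quotient by [M / r], and the maximum
     principle carries this inside. *)
  move=> z1; have H r : 0 < r < 1 -> nsq z <= r ^+ 2 -> p z <= M / r.
    move=> r01; have /andP[r0 r1] := r01.
    apply: (max_circle r01 hp cp) => w wr.
    have w1 : nsq w < 1 by rewrite wr expr_lt1// ltW.
    rewrite ler_pdivlMr// -(@ler_pM2r _ r)//.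
    have -> : p w * r * r = w.1 * P w + w.2 * Q w by rewrite pE wr; ring.
    have Mr : 0 <= M * r by rewrite mulr_ge0// ltW.
    have [|neg] := leP 0 (w.1 * P w + w.2 * Q w); last first.
      exact: le_trans (ltW neg) Mr.
    move=> pos; rewrite -(@ler_pXn2r _ 2)// (le_trans (cauchy_schwarz2 _ _ _ _))//.
    rewrite exprMn -/(nsq w) wr mulrC ler_pM2r ?exprn_gt0//; exact: bnd.
  rewrite leNgt; apply/negP => Mp.
  have pz0 : 0 < p z by exact: le_lt_trans Mp.
  (* This radius encloses [z] and lies strictly between [M / p z] and 1, so the bound [M / r] would
     be smaller than [p z]. *)
  pose r := (Num.max (M / p z) (Num.sqrt (nsq z)) + 1) / 2.
  have s1 : Num.sqrt (nsq z) < 1.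
    by rewrite -(@ltr_pXn2r _ 2) ?nnegrE ?sqrtr_ge0// expr1n sqr_sqrtr ?nsq_ge0.
  have M1 : M / p z < 1 by rewrite ltr_pdivrMr// mul1r.
  have m1 : Num.max (M / p z) (Num.sqrt (nsq z)) < 1 by rewrite gt_max M1.
  have mM : M / p z <= Num.max (M / p z) (Num.sqrt (nsq z)) by rewrite le_max lexx.
  have ms : Num.sqrt (nsq z) <= Num.max (M / p z) (Num.sqrt (nsq z)).
    by rewrite le_max lexx orbT.
  have s0 := sqrtr_ge0 (nsq z).
  have r01 : 0 < r < 1 by rewrite /r; apply/andP; split; lra.
  have : p z <= M / r.
    apply: H => //; have /andP[/ltW r0 _] := r01.
    by rewrite -[X in X <= _](sqr_sqrtr (nsq_ge0 z)) ler_pXn2r// /r; lra.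
  have /andP[r0 _] := r01.
  rewrite ler_pdivlMr// mulrC -ler_pdivlMr//.
  by apply/negP; rewrite -ltNge /r; lra.
split.
- by move=> z z1; rewrite pE; apply: ler_wpM2r; [exact: nsq_ge0|exact: pM].
- by rewrite -p0; apply: pM; rewrite nsq0.
- move=> eqM.
  have [z0 z01 pz0] : exists2 z, nsq z < 1 & p z = M.
    case: eqM => [AM|[z [z1 zn0 zM]]]; first by exists 0; rewrite ?nsq0 ?p0.
    exists z => //; apply/(mulIf (x := nsq z)); last by rewrite -pE.
    by rewrite gt_eqF// nsq_gt0.
  have pMM := max_disc_global hp cp pM z01 pz0.
  split; first by rewrite -p0 pMM// nsq0.
  by move=> z z1; rewrite pE pMM.
Qed.

(** [schwarz] bounds a real part; multiplying the function by a suitable constant turns this into a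
    bound on the modulus at a given point. *)
Lemma schwarz_nsq P Q A B M : 0 <= M -> holo [set z | nsq z < 1] P Q A B ->
  P 0 = 0 -> Q 0 = 0 -> (forall z, nsq z < 1 -> P z ^+ 2 + Q z ^+ 2 <= M ^+ 2) ->
  forall z, nsq z < 1 -> P z ^+ 2 + Q z ^+ 2 <= M ^+ 2 * nsq z.
Proof.
move=> M0 h P0 Q0 bnd z z1.
have [->|z0] := eqVneq z 0; first by rewrite P0 Q0 nsq0 mulr0 !expr0n addr0.
have n0 : 0 < nsq z by rewrite nsq_gt0.
(* the rotation by the conjugate of [w = h(z)/z] makes the quotient real at z *)
pose a := z.1 * P z + z.2 * Q z; pose b := z.1 * Q z - z.2 * P z.
have abE : a ^+ 2 + b ^+ 2 = nsq z * (P z ^+ 2 + Q z ^+ 2).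
  by rewrite /a /b /nsq; ring.
have ab0 : 0 <= a ^+ 2 + b ^+ 2 by rewrite addr_ge0 ?sqr_ge0.
set S := Num.sqrt (a ^+ 2 + b ^+ 2).
have S0 : 0 <= S := sqrtr_ge0 _.
have SE : S ^+ 2 = a ^+ 2 + b ^+ 2 by rewrite sqr_sqrtr.
have h' := holoM h (@holo_cst R [set z | nsq z < 1] a (- b)).
have MS : 0 <= M * S by rewrite mulr_ge0.
have [|||H _ _] := schwarz MS h'.
- by rewrite P0 Q0; ring.
- by rewrite P0 Q0; ring.
- move=> w w1; have -> : (P w * a - Q w * - b) ^+ 2 + (P w * - b + Q w * a) ^+ 2 =
    (P w ^+ 2 + Q w ^+ 2) * (a ^+ 2 + b ^+ 2) by ring.
  by rewrite exprMn SE ler_wpM2r//; exact: bnd.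
- have := H z z1.
  have -> : z.1 * (P z * a - Q z * - b) + z.2 * (P z * - b + Q z * a) = S ^+ 2.
    by rewrite SE /a /b; ring.
  move=> SM; have {}SM : S <= M * nsq z.
    have [->|Sn] := eqVneq S 0; first by rewrite mulr_ge0// nsq_ge0.
    by rewrite -(@ler_pM2r _ S) ?lt_def ?Sn// -expr2 mulrAC.
  have : S ^+ 2 <= (M * nsq z) ^+ 2 by rewrite ler_pXn2r// nnegrE mulr_ge0// ltW.
  by rewrite SE abE exprMn [nsq z ^+ 2]expr2 mulrA mulrC ler_pM2r.
Qed.

End Schwarz.

(** * The identity theorem *)

Section Identity.
Variable R : realType.
Implicit Types (P Q A B f g : R * R -> R) (z w c m : R * R) (U : set (R * R)).
Implicit Types (a b k r s t K M e : R).

Lemma is_diff_lin2_unique f z (a1 b1 a2 b2 : R) :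
  is_diff z f (lin2 a1 b1) -> is_diff z f (lin2 a2 b2) -> a1 = a2 /\ b1 = b2.
Proof.
move=> d1 d2; have E : lin2 a1 b1 = lin2 a2 b2 :> (R * R -> R).
  by rewrite -(diff_val (is_diff_def := d1)) -(diff_val (is_diff_def := d2)).
have E1 := congr1 (fun g => g (1, 0)) E; have E2 := congr1 (fun g => g (0, 1)) E.
by move: E1 E2; rewrite /lin2 /= !mulr1 !mulr0 !addr0 !add0r.
Qed.

(** Induction on [n], dividing by [zeta]: the quotient still vanishes near 0, and by [schwarz_nsq]
    it still satisfies the bound [M]. *)
Lemma holo_flat P Q A B M e n : 0 <= M -> 0 < e ->
  holo [set z | nsq z < 1] P Q A B ->
  (forall z, nsq z < e -> P z = 0 /\ Q z = 0) ->
  (forall z, nsq z < 1 -> P z ^+ 2 + Q z ^+ 2 <= M ^+ 2) ->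
  forall z, nsq z < 1 -> P z ^+ 2 + Q z ^+ 2 <= M ^+ 2 * nsq z ^+ n.
Proof.
move=> M0 e0; elim: n P Q A B => [|n IHn] P Q A B h flat bnd z z1.
  by rewrite expr0 mulr1; exact: bnd.
have [P0 Q0] : P 0 = 0 /\ Q 0 = 0 by apply: flat; rewrite nsq0.
pose P2 z := z.1 / nsq z; pose Q2 z := - (z.2 / nsq z).
pose P' z := P z * P2 z - Q z * Q2 z; pose Q' z := P z * Q2 z + Q z * P2 z.
have nP' w : w != 0 -> P' w ^+ 2 + Q' w ^+ 2 = (P w ^+ 2 + Q w ^+ 2) / nsq w.
  rewrite -nsq_eq0 => w0; rewrite /P' /Q' /P2 /Q2.
  by move: w0; rewrite /nsq => w0; field.
have flat' w : nsq w < e -> P' w = 0 /\ Q' w = 0.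
  by move=> /flat[Pw Qw]; rewrite /P' /Q' Pw Qw !mul0r addr0 subr0.
have bnd' w : nsq w < 1 -> P' w ^+ 2 + Q' w ^+ 2 <= M ^+ 2.
  have [->|w0 w1] := eqVneq w 0.
    by have [|-> ->] := flat' 0; rewrite ?nsq0// expr0n addr0 sqr_ge0.
  rewrite nP'// ler_pdivrMr ?nsq_gt0//.
  exact: (schwarz_nsq M0 h P0 Q0 bnd).
have [A' [B' h']] : exists A' B', holo [set z | nsq z < 1] P' Q' A' B'.
  have s1 : [set z : R * R | 0 < nsq z < 1] `<=` [set z | nsq z < 1].
    by move=> w /andP[].
  have s2 : [set z : R * R | 0 < nsq z < 1] `<=` [set z | nsq z != 0].
    by move=> w /andP[/gt_eqF /= ->].
  have := holoM (holo_sub s1 h) (holo_sub s2 (@holo_inv R)).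
  set A1 := (X in holo _ _ _ X _); set B1 := (X in holo _ _ _ _ X) => h1.
  (* The quotient is zero on a whole neighbourhood of 0, so its derivative at 0 is 0. *)
  exists (fun w => if w == 0 then 0 else A1 w), (fun w => if w == 0 then 0 else B1 w).
  have e1 : 0 < Num.min e 1 by rewrite lt_min e0 ltr01.
  have h0 : holo [set w | nsq w < Num.min e 1] P' Q'
      (fun w => if w == 0 then 0 else A1 w) (fun w => if w == 0 then 0 else B1 w).
    apply: (@holo_near _ _ (fun=> 0) (fun=> 0) (fun=> 0) (fun=> 0) _ _ _ _ _
      (@holo_cst R [set w | nsq w < Num.min e 1] 0 0)) => v ve.
    have := open_nbhs_nbhs (conj (@open_disc R (Num.min e 1)) ve).
    apply: filterS => w /=; rewrite lt_min => /andP[we w1].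
    have [-> ->] := flat' w we; case: eqVneq => [_|w0]; first by split.
    have [|dP' dQ' _ _] := h1 w; first by rewrite /= nsq_gt0 w0.
    have nw : \forall v \near w, 0 = Q' v.
      have := open_nbhs_nbhs (conj (@open_disc R e) we).
      by apply: filterS => u /flat'[].
    have d0 : is_diff w Q' (lin2 0 0).
      exact: is_diff_lin2_near nw (is_diff_lin2_cst _ _).
    by have [-> ->] := is_diff_lin2_unique dQ' d0; split.
  move=> w /= w1; have [w0|/eqP w0] := pselect (w = 0).
    by refine (h0 w _); rewrite /= w0 nsq0.
  have w01 : 0 < nsq w < 1 by rewrite nsq_gt0 w0.
  refine (holo_near _ h1 w01) => v v01.
  have := open_nbhs_nbhs (conj (@open_punctured_disc R 1) v01).
  apply: filterS => u /= /andP[u0 _].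
  by move: u0; rewrite nsq_gt0 => /negbTE ->; split.
have := IHn _ _ _ _ h' flat' bnd' z z1.
have [->|z0] := eqVneq z 0.
  by rewrite P0 Q0 expr0n addr0 mulr_ge0 ?sqr_ge0 ?exprn_ge0// nsq_ge0.
by rewrite nP'// ler_pdivrMr ?nsq_gt0// [nsq z ^+ n.+1]exprSr mulrA.
Qed.

(** The bounds of [holo_flat] tend to 0 with [n], as [nsq z < 1]. *)
Lemma holo_flat_eq0 P Q A B M e : 0 <= M -> 0 < e ->
  holo [set z | nsq z < 1] P Q A B ->
  (forall z, nsq z < e -> P z = 0 /\ Q z = 0) ->
  (forall z, nsq z < 1 -> P z ^+ 2 + Q z ^+ 2 <= M ^+ 2) ->
  forall z, nsq z < 1 -> P z = 0.
Proof.
move=> M0 e0 h flat bnd z z1; apply/eqP; rewrite -sqrf_eq0 eq_le sqr_ge0 andbT.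
have : (M ^+ 2 * nsq z ^+ n) @[n --> \oo] --> M ^+ 2 * 0.
  apply: cvgM; first exact: cvg_cst.
  by apply: cvg_expr; rewrite ger0_norm// nsq_ge0.
rewrite mulr0 => cv; apply: (cvgr_to_ge cv); near=> n.
apply: le_trans (holo_flat n M0 e0 h flat bnd z1).
by rewrite lerDl sqr_ge0.
Unshelve. all: by end_near. Qed.

(* Extending [P + iQ] by 0 below the real axis stays holomorphic when it vanishes
   there; the extension is flat around points just below 0, where repeated
   division by [zeta] and the maximum principle annihilate it. *)
Lemma holo_eq0_upper P Q A B : holo [set z | nsq z < 1] P Q A B ->
  (forall x : R, x ^+ 2 < 1 -> P (x, 0) = 0 /\ Q (x, 0) = 0) ->
  forall z, nsq z < 1 -> 0 <= z.2 -> P z = 0.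
Proof.
move=> h axis z z1 z20.
pose cut f w := if 0 <= w.2 then f w else 0 : R.
have along f (x a b : R) : (forall x : R, x ^+ 2 < 1 -> f (x, 0) = 0) -> x ^+ 2 < 1 ->
    is_diff (x, 0 : R) f (lin2 a b) -> a = 0.
  move=> f0 x1 df.
  have D := is_diff_path df (is_derive_id x 1) (is_derive_cst (0 : R) x 1) erefl.
  have nx : \forall v \near x, f (v, 0) = cst 0 v.
    have : \forall v \near x, v ^+ 2 < 1.
      have : {for x, continuous (fun v : R => v ^+ 2)} by exact: exprn_continuous.
      by move=> /cvgr_lt; exact.
    by apply: filterS => v; exact: f0.
  have D0 := near_eq_is_derive nx D.
  have [_ E0] := D0; have [_ E1] := is_derive_cst (0 : R) x 1.
  by move: E0; rewrite E1 mulr1 mulr0 addr0.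
(* The two parts of the complex derivative are the [x]-derivatives of [P] and [Q], which vanish at
   points of the axis. *)
have axisAB z' : nsq z' < 1 -> z'.2 = 0 ->
    [/\ P z' = 0, Q z' = 0, A z' = 0 & B z' = 0].
  case: z' => x y /= n1 y0; subst y.
  have x1 : x ^+ 2 < 1 by move: n1; rewrite /nsq /= expr0n addr0.
  have [P0 Q0] := axis x x1; have [dP dQ _ _] := h (x, 0) n1; split => //.
    by apply: along x1 dP => v /axis[].
  by apply: along x1 dQ => v /axis[].
have cutE f w : 0 <= w.2 -> cut f w = f w by rewrite /cut => ->.
have cut_le f w : `|cut f w| <= `|f w|.
  by rewrite /cut; case: ifP => // _; rewrite normr0.
have hc : holo [set z | nsq z < 1] (cut P) (cut Q) (cut A) (cut B).
  move=> w w1; have [w2|w2|w2] := ltgtP w.2 0.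
  - refine (@holo_near _ _ (fun=> 0) (fun=> 0) (fun=> 0) (fun=> 0) _ _ _ _ _
      (@holo_cst R [set w | w.2 < 0] 0 0) w w2) => v v2.
    have : \forall u \near v, u.2 < 0.
      have : {for v, continuous (@snd R R)} by exact: cvg_snd.
      by move=> /cvgr_lt /(_ 0 v2).
    by apply: filterS => u u2; rewrite /cut leNgt u2.
  - have h2 := holo_sub (@subIsetl _ _ [set w | 0 < w.2]) h.
    refine (holo_near _ h2 (conj w1 w2)) => v [_ v2].
    have : \forall u \near v, 0 < u.2.
      have : {for v, continuous (@snd R R)} by exact: cvg_snd.
      by move=> /cvgr_gt /(_ 0 v2).
    by apply: filterS => u u2; rewrite /cut ltW.
  (* On the axis, the cut function is dominated by one that vanishes there to first order, so it is
     differentiable with zero differential. *)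
  - have [P0 Q0 A0 B0] := axisAB w w1 w2.
    have [dP dQ cA cB] := h w w1.
    have key f : f w = 0 -> is_diff w f (lin2 0 0) -> is_diff w (cut f) (lin2 0 0).
      move=> f0 /is_diff_lin2P df; apply/is_diff_lin2P => e e0.
      apply: filterS (df e e0) => v; rewrite (cutE f w) ?w2// f0 /lin2 !mul0r addr0 !subr0.
      by apply: le_trans; exact: cut_le.
    have ckey f : f w = 0 -> {for w, continuous f} -> {for w, continuous (cut f)}.
      move=> f0 /cvgrPdist_le cf; apply/cvgrPdist_le => e e0.
      apply: filterS (cf e e0) => v; rewrite (cutE f w) ?w2// f0 !sub0r !normrN.
      by apply: le_trans; exact: cut_le.
    split; last 2 first.
    + exact: ckey.
    + exact: ckey.
    + move: dP; rewrite !cutE ?w2// A0 B0 oppr0; exact: key.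
    + move: dQ; rewrite !cutE ?w2// A0 B0; exact: key.
set n := Num.sqrt (nsq z).
have n0 : 0 <= n := sqrtr_ge0 _.
have n2 : n ^+ 2 = nsq z by rewrite sqr_sqrtr// nsq_ge0.
have n1 : n < 1 by rewrite -(@ltr_pXn2r _ 2) ?nnegrE// expr1n n2.
(* The disc of centre [(0, - t)] and radius [s] contains [z], as [n + t < s], and lies well inside
   the unit disc, as [s + t < 1]; its centre is below the axis. *)
pose t := (1 - n) / 4; pose s := (1 + n) / 2.
have t0 : 0 < t by rewrite divr_gt0// subr_gt0.
have s0 : 0 < s by rewrite divr_gt0// ltr_wpDr.
have st1 : s + t < 1 by rewrite /s /t; lra.
pose phi := caffine (0, - t) (s, 0).
have phiE w : phi w = (s * w.1, s * w.2 - t).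
  by rewrite /phi /caffine /lin2 /=; congr pair; ring.
have norm2 w r : 0 <= r -> nsq w <= r ^+ 2 -> `|w.2| <= r.
  exact: norm_snd_le_nsq.
have phi_in w : nsq w < 1 -> nsq (phi w) <= (s + t) ^+ 2.
  move=> w1; have : `|w.2| <= 1 by apply: norm2; rewrite ?expr1n// ltW.
  rewrite ler_norml => /andP[l1 _]; rewrite phiE /nsq /=.
  have -> : (s * w.1) ^+ 2 + (s * w.2 - t) ^+ 2 =
    s ^+ 2 * nsq w - 2 * s * t * w.2 + t ^+ 2 by rewrite /nsq; ring.
  have : s ^+ 2 * nsq w <= s ^+ 2 by rewrite ler_piMr ?sqr_ge0// ltW.
  have : 2 * s * t * (- w.2) <= 2 * s * t.
    have st0 : 0 < 2 * s * t by apply: mulr_gt0 => //; apply: mulr_gt0.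
    by rewrite -subr_ge0 -[X in X - _]mulr1 -mulrBr mulr_ge0 ?(ltW st0)// opprK; lra.
  by move=> *; lra.
have stlt : (s + t) ^+ 2 < 1 by rewrite expr_lt1// addr_ge0// ltW.
have sub : [set w | nsq w < 1] `<=` phi @^-1` [set z | nsq z < 1].
  by move=> w w1; exact: le_lt_trans (phi_in w w1) stlt.
have hphi := holo_sub sub (holo_caffine (c := (0, - t)) (m := (s, 0)) hc).
(* A bound on the closed disc of radius [s + t] comes from compactness. *)
have [M M0 bM] : exists2 M, 0 <= M &
    forall w, nsq w <= (s + t) ^+ 2 -> P w ^+ 2 + Q w ^+ 2 <= M ^+ 2.
  pose D := [set w : R * R | nsq w <= (s + t) ^+ 2].
  have cPQ : {within D, continuous (fun w => P w ^+ 2 + Q w ^+ 2)}.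
    apply/continuous_in_subspaceT => w; rewrite inE => Dw.
    have [cP cQ] := holo_continuous h (le_lt_trans Dw stlt).
    by apply: cvgD; apply: cvgM.
  have [||v _ vmax] := compact_EVT_max _ _ cPQ.
  - by exists 0; rewrite /D /= nsq0 sqr_ge0.
  - by apply: disc_compact; rewrite addr_ge0// ltW.
  exists (Num.sqrt (P v ^+ 2 + Q v ^+ 2)) => [|w Dw]; first exact: sqrtr_ge0.
  by rewrite sqr_sqrtr ?addr_ge0 ?sqr_ge0//; apply: vmax; rewrite inE.
have ts0 : 0 < (t / s) ^+ 2 by rewrite exprn_gt0// divr_gt0.
have flat w : nsq w < (t / s) ^+ 2 -> (cut P \o phi) w = 0 /\ (cut Q \o phi) w = 0.
  move=> wts; suff w2 : (phi w).2 < 0 by rewrite /= /cut leNgt w2.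
  rewrite phiE /= subr_lt0 mulrC -ltr_pdivlMr//.
  have ts : 0 <= t / s by rewrite divr_ge0// ltW.
  rewrite ltNge; apply/negP => wt; move: wts; rewrite ltNge => /negP; apply.
  rewrite (@le_trans _ _ (w.2 ^+ 2)) ?lerDr ?sqr_ge0//.
  by rewrite ler_pXn2r ?nnegrE// (le_trans ts).
have bnd w : nsq w < 1 -> (cut P \o phi) w ^+ 2 + (cut Q \o phi) w ^+ 2 <= M ^+ 2.
  move=> w1; apply: le_trans (bM _ (phi_in w w1)).
  by rewrite /= /cut; case: ifP => // _; rewrite expr0n addr0 addr_ge0 ?sqr_ge0.
pose w := (z.1 / s, (z.2 + t) / s).
have wE : phi w = z.
  rewrite phiE [RHS]surjective_pairing /w /=.
  by congr pair; field; rewrite gt_eqF.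
have w1 : nsq w < 1.
  have : `|z.2| <= n by apply: norm2; rewrite ?n2.
  rewrite ler_norml => /andP[_ l2].
  have -> : nsq w = (nsq z + 2 * t * z.2 + t ^+ 2) / s ^+ 2.
    by rewrite /nsq /w /=; field; rewrite gt_eqF.
  rewrite ltr_pdivrMr ?exprn_gt0// mul1r -n2.
  apply: (@le_lt_trans _ _ ((n + t) ^+ 2)).
    have : t * z.2 <= t * n by rewrite ler_pM2l.
    by rewrite sqrrD -[_ *+ 2]mulr_natl; lra.
  have nt : n + t < s by rewrite /s /t; lra.
  by rewrite ltr_pXn2r// nnegrE ?addr_ge0 ?(ltW t0) ?(ltW s0).
have : cut P (phi w) = 0 := holo_flat_eq0 M0 ts0 hphi flat bnd w1.
by rewrite wE /cut z20.
Qed.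

(** The half-turn [z |-> - z] preserves the disc and the axis and exchanges the two half discs. *)
Lemma holo_eq0_axis P Q A B : holo [set z | nsq z < 1] P Q A B ->
  (forall x : R, x ^+ 2 < 1 -> P (x, 0) = 0 /\ Q (x, 0) = 0) ->
  forall z, nsq z < 1 -> P z = 0.
Proof.
move=> h axis z z1; have [z2|z2] := leP 0 z.2; first exact: (holo_eq0_upper h).
have rE w : caffine 0 (-1, 0) w = - w.
  by case: w => x y; rewrite -[RHS]/(- x, - y) /caffine /lin2 /=; congr pair; ring.
have sub : [set w : R * R | nsq w < 1] `<=` caffine 0 (-1, 0) @^-1` [set z | nsq z < 1].
  move=> w w1; suff: nsq (caffine 0 (-1, 0) w) < 1 by [].
  by rewrite rE /nsq /= !sqrrN.
have h' := holo_sub sub (holo_caffine (c := 0) (m := (-1, 0)) h).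
have := holo_eq0_upper h' _ (z := - z); rewrite /= rE opprK; apply.
- move=> x x1; rewrite !rE -[- (x, 0)]/(- x, - 0) oppr0.
  by apply: axis; rewrite sqrrN.
- by rewrite /nsq /= !sqrrN.
- by rewrite oppr_ge0 ltW.
Qed.


End Identity.

(** * The inner product of octonions *)

Section OctonionInner.
Variable R : realType.
Implicit Types (a u v w I : octonion R) (x y : R).

Definition dot u v : R := \sum_k u 0 k * v 0 k.

Lemma dotE u v : let x k := u 0 (inord k) in let y k := v 0 (inord k) in
  dot u v = x 0%N * y 0%N + x 1%N * y 1%N + x 2%N * y 2%N + x 3%N * y 3%N
          + x 4%N * y 4%N + x 5%N * y 5%N + x 6%N * y 6%N + x 7%N * y 7%N.
Proof.
rewrite /dot; under eq_bigr do rewrite -[X in u 0 X]inord_val -[X in v 0 X]inord_val.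
by rewrite !big_ord_recl big_ord0 addr0 /= !addrA.
Qed.

Lemma dotC u v : dot u v = dot v u.
Proof. by apply: eq_bigr => k _; rewrite mulrC. Qed.

Lemma dotDl u v w : dot (u + v) w = dot u w + dot v w.
Proof. by rewrite -big_split; apply: eq_bigr => k _; rewrite mxE mulrDl. Qed.

Lemma dotZl (k : R) u v : dot (k *: u) v = k * dot u v.
Proof. by rewrite mulr_sumr; apply: eq_bigr => i _; rewrite mxE mulrA. Qed.

Lemma dotNl u v : dot (- u) v = - dot u v.
Proof. by rewrite -scaleN1r dotZl mulN1r. Qed.

Lemma dotBl u v w : dot (u - v) w = dot u w - dot v w.
Proof. by rewrite dotDl dotNl. Qed.

Lemma dot0l u : dot 0 u = 0.
Proof. by rewrite -(scale0r 0) dotZl mul0r. Qed.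

Lemma dotDr u v w : dot w (u + v) = dot w u + dot w v.
Proof. by rewrite dotC dotDl !(dotC w). Qed.

Lemma dotZr (k : R) u v : dot v (k *: u) = k * dot v u.
Proof. by rewrite dotC dotZl (dotC v). Qed.

Lemma dotBr u v w : dot w (u - v) = dot w u - dot w v.
Proof. by rewrite dotC dotBl !(dotC w). Qed.

Lemma dot_ge0 u : 0 <= dot u u.
Proof. by apply: sumr_ge0 => k _; rewrite -expr2 sqr_ge0. Qed.

Lemma onorm_sqr u : onorm u ^+ 2 = dot u u.
Proof.
rewrite /onorm sqr_sqrtr; last by apply: sumr_ge0 => k _; rewrite sqr_ge0.
by apply: eq_bigr => k _; rewrite expr2.
Qed.

Lemma onorm_ge0 u : 0 <= onorm u.
Proof. exact: sqrtr_ge0. Qed.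

Lemma dot_eq0 u : dot u u = 0 -> u = 0.
Proof.
move=> /psumr_eq0P H; apply/rowP => k; rewrite mxE; apply/eqP.
by rewrite -sqrf_eq0 expr2 H// => i _; rewrite -expr2 sqr_ge0.
Qed.

Lemma onorm_eq0 u : onorm u = 0 -> u = 0.
Proof. by move=> u0; apply: dot_eq0; rewrite -onorm_sqr u0 expr0n. Qed.

Lemma onorm0 : onorm (0 : octonion R) = 0.
Proof. by rewrite -(scale0r (0 : octonion R)) onormZ normr0 mul0r. Qed.

Lemma dot_oneE u : dot u (oone R) = ore u.
Proof.
rewrite /dot (bigD1 0)//= big1 => [|k k0]; first by rewrite mxE !eqxx mulr1 addr0.
by rewrite mxE (negbTE k0) andbF mulr0.
Qed.

(** The polarised form of the multiplicativity of the norm. *)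
Lemma dot_omul2 a u v : dot (omul a u) (omul a v) = dot a a * dot u v.
Proof.
rewrite !dotE !omulE !mxE !inordK//=; clear.
by generalize_entries a; generalize_entries u; generalize_entries v => *; ring.
Qed.

(** The adjoint of left multiplication by [a] is left multiplication by its conjugate, written as
    [2 Re a - a]; the next lemma is the analogue on the right. *)
Lemma dot_omul_adj a u v :
  dot (omul a u) v = 2 * ore a * dot u v - dot u (omul a v).
Proof.
rewrite /ore ord0_inord !dotE !omulE !mxE !inordK//=; clear.
by generalize_entries a; generalize_entries u; generalize_entries v => *; ring.
Qed.

Lemma dot_omul_adjr a u v :
  dot u (omul v a) = 2 * ore a * dot u v - dot (omul u a) v.
Proof.
rewrite /ore ord0_inord !dotE !omulE !mxE !inordK//=; clear.
by generalize_entries a; generalize_entries u; generalize_entries v => *; ring.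
Qed.

Lemma omul_cpoint I x y a : omul (cpoint I x y) a = x *: a + y *: omul I a.
Proof.
apply/rowP => i; rewrite -[i]inord_val; move: (val i) (ltn_ord i) => k k8.
rewrite 2!omulE /cpoint /oreal !mxE -!val_eqE /= !inordK//.
case: k k8 => [|[|[|[|[|[|[|[|//]]]]]]]] _ /=; clear;
  by generalize_entries a; generalize_entries I => *; ring.
Qed.

Lemma omul_pure I : ore I = 0 -> omul I I = - (dot I I *: oone R).
Proof.
rewrite /ore ord0_inord => I0; apply/rowP => i.
rewrite omulE dotE !mxE -!val_eqE /= I0; clear I0.
case: i => [[|[|[|[|[|[|[|[|//]]]]]]]] ?] /=; by generalize_entries I => *; ring.
Qed.

Lemma imag_sphereP I : ore I = 0 -> dot I I = 1 -> imag_sphere I.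
Proof. by move=> I0 I1; rewrite /imag_sphere /= omul_pure// I1 scale1r. Qed.

End OctonionInner.

(** * Imaginary units, Bessel's inequality and orthogonality across slices *)

Section OctonionSphere.
Variable R : realType.
Implicit Types (a u v w I : octonion R) (x y : R).

Section ImaginaryUnit.
Variable I : octonion R.
Hypothesis SI : imag_sphere I.

Lemma dot_sphere_skew u v : dot (omul I u) v = - dot u (omul I v).
Proof.
by have [I0 _] := imag_sphere_ore_onorm SI; rewrite dot_omul_adj I0 mulr0 mul0r sub0r.
Qed.

Lemma dot_sphere_isom u v : dot (omul I u) (omul I v) = dot u v.
Proof.
have [_ I1] := imag_sphere_ore_onorm SI.
by rewrite dot_omul2 -onorm_sqr I1 expr1n mul1r.
Qed.

Lemma dot_sphere_orth u : dot u (omul I u) = 0.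
Proof. by have := dot_sphere_skew u u; rewrite dotC => ?; lra. Qed.

Lemma onorm_cpoint x y : onorm (cpoint I x y) ^+ 2 = x ^+ 2 + y ^+ 2.
Proof.
have [I0 I1] := imag_sphere_ore_onorm SI.
have Io : dot I (oone R) = 0 by rewrite dot_oneE.
rewrite onorm_sqr /cpoint /oreal dotDl !dotDr !dotZl !dotZr (dotC (oone R) I) Io.
by rewrite -!onorm_sqr I1 onorm_oone; ring.
Qed.

Lemma oball_cpoint x y : oball (cpoint I x y) <-> nsq (x, y) < 1.
Proof.
rewrite /oball /= -(@ltr_pXn2r _ 2)// ?nnegrE ?onorm_ge0// expr1n.
by rewrite onorm_cpoint.
Qed.

(** [u] and [omul I u] are orthogonal of equal length; the inequality expresses that the residual of
    [dot u u *: v] after projection has nonnegative square norm. *)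
Lemma bessel u v : dot v u ^+ 2 + dot v (omul I u) ^+ 2 <= dot v v * dot u u.
Proof.
set p := dot v u; set q := dot v (omul I u).
have [u0|u0] := eqVneq (dot u u) 0.
  have uE := dot_eq0 u0; rewrite /p /q u0 mulr0.
  have -> : dot v (omul I u) = 0.
    by apply/eqP; rewrite dotC dot_sphere_skew uE dot0l oppr0.
  by rewrite uE dotC dot0l !expr0n addr0.
have up : 0 < dot u u by rewrite lt_def u0 dot_ge0.
have := dot_ge0 (dot u u *: v - (p *: u + q *: omul I u)).
rewrite !(dotBl, dotBr, dotDl, dotDr, dotZl, dotZr) dot_sphere_isom.
rewrite (dotC (omul I u) u) dot_sphere_orth (dotC (omul I u) v) (dotC u v) -/p -/q.
set n := dot u u in up *; set m := dot v v => H.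
have {}H : 0 <= n * (m * n - (p ^+ 2 + q ^+ 2)) by move: H; congr (_ <= _); ring.
by move: H; rewrite pmulr_rge0// subr_ge0.
Qed.

End ImaginaryUnit.

Lemma cauchy_schwarz u v : dot u v <= onorm u * onorm v.
Proof.
have SI := imag_unit0 R; have := bessel SI v u.
rewrite -!onorm_sqr -exprMn => H.
have [d0|/ltW d0] := leP 0 (dot u v); last first.
  by rewrite (le_trans d0)// mulr_ge0 ?onorm_ge0.
rewrite -(@ler_pXn2r _ 2)// ?nnegrE ?mulr_ge0 ?onorm_ge0//.
by apply: le_trans H; rewrite lerDl sqr_ge0.
Qed.

Lemma exists_cpoint w : exists I x y, imag_sphere I /\ w = cpoint I x y.
Proof.
have imw : ore (oim w) = 0.
  by rewrite /oim /oreal /ore !mxE !eqxx mulr1 subrr.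
have [w0|w0] := eqVneq (oim w) 0.
  exists (imag_unit (0 : octonion R)), (ore w), 0; split; first exact: imag_unit0.
  by rewrite /cpoint scale0r addr0; apply/eqP; rewrite -subr_eq0 -/(oim w) w0.
have n0 : onorm (oim w) != 0 by apply: contra_neq w0 => /onorm_eq0.
exists ((onorm (oim w))^-1 *: oim w), (ore w), (onorm (oim w)); split.
  apply: imag_sphereP.
    by rewrite -dot_oneE dotZl dot_oneE imw mulr0.
  by rewrite dotZl dotZr -onorm_sqr; field.
by rewrite /cpoint scalerA mulfV// scale1r /oim addrC subrK.
Qed.

(** Every octonion lies in some [cplane I], so [v] is orthogonal to all right multiples [omul u a].
    Hence [w], the product of [v] with the conjugate of [a], is 0. *)
Lemma orth_slices_eq0 a v : onorm a = 1 -> dot v a = 0 ->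
  (forall I, imag_sphere I -> dot v (omul I a) = 0) -> v = 0.
Proof.
move=> a1 va vIa; pose w := 2 * ore a *: v - omul v a.
have adj u : dot v (omul u a) = dot w u.
  by rewrite dot_omul_adjr /w dotBl dotZl.
have [I [x [y [SI wE]]]] := exists_cpoint w.
have w0 : w = 0.
  apply: dot_eq0; rewrite -adj wE omul_cpoint dotDr !dotZr va vIa//.
  by rewrite !mulr0 addr0.
have va_eq : omul v a = 2 * ore a *: v by apply/eqP; rewrite eq_sym -subr_eq0 -/w w0.
have vva : dot v (omul v a) = 0 by rewrite adj w0 dot0l.
(* Since [omul v a] is [2 Re a] times [v], its square norm is a multiple of
   [dot v (omul v a) = dot w v = 0]. *)
apply: dot_eq0; rewrite -onorm_sqr -[onorm v]mulr1 -a1 -onormM onorm_sqr.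
by rewrite {1}va_eq dotZl vva mulr0.
Qed.

End OctonionSphere.

(** * Slices *)

Section DotCalculus.
Variable R : realType.
Implicit Types (u v w : octonion R).

Lemma dot_continuous u : continuous (fun v => dot v u).
Proof.
move=> v; apply: differentiable_continuous.
rewrite (_ : (fun v => dot v u) = \sum_k (fun v : octonion R => v 0 k * u 0 k)).
  apply: differentiable_sum => k; apply: differentiableM => //.
  exact: differentiable_coord.
by apply/funext => w; rewrite fct_sumE.
Qed.

Lemma is_derive_dot (g : R -> octonion R) (t : R) u :
  derivable g t 1 -> is_derive t 1 (fun s => dot (g s) u) (dot (derive1 g t) u).
Proof.
move=> dg; rewrite (_ : (fun s => dot (g s) u) = \sum_k (fun s => g s 0 k * u 0 k)).
  have -> : dot (derive1 g t) u = \sum_k derive1 (fun s => g s 0 k) t * u 0 k.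
    by rewrite derive1E derive_mx//; apply: eq_bigr => k _; rewrite mxE derive1E.
  apply: is_derive_sum => k.
  have dk : is_derive t 1 (fun s => g s 0 k) (derive1 (fun s => g s 0 k) t).
    by rewrite derive1E; apply/derivableP; exact: (derivable_mxP _ _ _).1 dg 0 k.
  apply: (is_derive_eq (is_deriveM dk (is_derive_cst (u 0 k) t 1))).
  by rewrite scaler0 add0r /GRing.scale /= mulrC.
by apply/funext => s; rewrite fct_sumE.
Qed.

(** The test vector is [v] normalised. This reduces norm bounds to bounds on components. *)
Lemma onorm_le_dot v (c : R) : 0 <= c ->
  (forall u, onorm u = 1 -> dot v u <= c) -> onorm v <= c.
Proof.
move=> c0 H; have [v0|v0] := eqVneq (onorm v) 0; first by rewrite v0.
have := H ((onorm v)^-1 *: v); rewrite onormZ normfV ger0_norm ?onorm_ge0//.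
by rewrite mulVf// dotZr -onorm_sqr expr2 mulrA mulVf// mul1r => /(_ erefl).
Qed.

Lemma dot_ext v w : (forall u, dot v u = dot w u) -> v = w.
Proof.
by move=> H; apply/eqP; rewrite -subr_eq0; apply/eqP/dot_eq0; rewrite dotBl H subrr.
Qed.

End DotCalculus.

(** * Slice functions as families of holomorphic pairs, and their Schwarz bounds *)

Section Slice.
Variables (R : realType) (f : octonion R -> octonion R).
Hypothesis f_regular : slice_regular f (@oball R).
Implicit Types (z w : R * R) (u v : octonion R).

Let D := [set z : R * R | nsq z < 1].

(** The right-hand side does not involve [I]; this is what links the slices in the extremal case. *)
Lemma slice_dx_real I x : slice_dx f I x 0 = derive1 (f \o @oreal R) x.
Proof.
rewrite /slice_dx; congr (derive1 _ x); apply/funext => t /=.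
by rewrite /Defs.cpoint scale0r addr0.
Qed.

Lemma slice_deriv0E : slice_deriv f 0 = derive1 (f \o @oreal R) 0.
Proof.
have SI := imag_unit0 R; set I := imag_unit 0 in SI.
have c0 : cpoint I 0 0 = 0 by rewrite /Defs.cpoint /oreal !scale0r addr0.
have b0 : oball (cpoint I 0 0) by rewrite c0 /oball /= onorm0.
rewrite -[X in slice_deriv f X]c0 (slice_derivE f_regular SI b0).
by apply: slice_deriv_on_real; have [] := f_regular SI b0.
Qed.

Variable I : octonion R.
Hypothesis SI : imag_sphere I.

Definition slice_fun z := f (cpoint I z.1 z.2).
Local Notation F := slice_fun.

Lemma slice_fun0 : F 0 = f 0.
Proof. by rewrite /slice_fun /Defs.cpoint /oreal !scale0r addr0. Qed.

Local Notation dF := (fun z => slice_dx f I z.1 z.2).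

(** Pairing the slice Cauchy-Riemann equation with [omul I v] expresses the [y]-derivative of each
    component through the [x]-derivative; [v = u] and [v = omul I u] give the two classical
    equations. *)
Lemma slice_holo u : holo D (fun z => dot (F z) u) (fun z => dot (F z) (omul I u))
  (fun z => dot (dF z) u) (fun z => dot (dF z) (omul I u)).
Proof.
have reg z (Dz : D z) := f_regular SI
  ((oball_cpoint SI z.1 z.2).2 (eq_ind _ D Dz _ (surjective_pairing z))).
have CR z v : D z -> dot (slice_dy f I z.1 z.2) v = - dot (dF z) (omul I v).
  move=> /reg[_ _ _ _ /eqP]; rewrite scaler_eq0 invr_eq0 pnatr_eq0 /= => /eqP E.
  have := congr1 (fun x => dot x (omul I v)) E.
  rewrite dot0l dotDl dot_sphere_isom// => /eqP.
  by rewrite addrC addr_eq0 => /eqP.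
(* [I (I v) = - v] is obtained inside the inner product, from skewness and isometry of left
   multiplication by [I]. *)
have II v z : dot (dF z) (omul I (omul I v)) = - dot (dF z) v.
  by rewrite dotC dot_sphere_skew// dot_sphere_isom// dotC.
have nD z : D z -> \forall w \near z, D w.
  by move=> Dz; exact: (open_nbhs_nbhs (conj (@open_disc R 1) Dz)).
have dx z v : D z -> \forall w \near z,
    is_derive (w.1 : R) 1 (fun t => dot (F (t, w.2)) v) (dot (dF w) v).
  move=> /nD; apply: filterS => w /reg[d _ _ _ _]; exact: is_derive_dot d.
have dy z v : D z -> \forall w \near z,
    is_derive (w.2 : R) 1 (fun t => dot (F (w.1, t)) v)
      (dot (slice_dy f I w.1 w.2) v).
  move=> /nD; apply: filterS => w /reg[_ d _ _ _]; exact: is_derive_dot d.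
have cx z v : D z -> {for z, continuous (fun w => dot (dF w) v)}.
  case: z => x y Dz; have [_ _ c _ _] := reg (x, y) Dz.
  have := @continuous_comp _ _ _ _ (fun p : octonion R => dot p v) _ c
    (@dot_continuous R v _).
  by apply.
have cy z v : D z -> {for z, continuous (fun w => dot (slice_dy f I w.1 w.2) v)}.
  case: z => x y Dz; have [_ _ _ c _] := reg (x, y) Dz.
  have := @continuous_comp _ _ _ _ (fun p : octonion R => dot p v) _ c
    (@dot_continuous R v _).
  by apply.
move=> z Dz; split; [| |exact: cx|exact: cx].
- have := @partial_is_diff R (fun w => dot (F w) u) _ _ z
    (dx z u Dz) (dy z u Dz) (cx z u Dz) (cy z u Dz).
  by rewrite CR.
- have := @partial_is_diff R (fun w => dot (F w) (omul I u)) _ _ z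
    (dx z (omul I u) Dz) (dy z (omul I u) Dz)
    (cx z (omul I u) Dz) (cy z (omul I u) Dz).
  by rewrite CR// II opprK.
Qed.


(* For [z] and [w] in the closed unit disc, [lambda |-> F(lambda z) - F(lambda w)]
   is bounded by 2 and vanishes at 0, so the Schwarz lemma applies to each of its
   components. *)
Hypothesis diam2 : forall z w, D z -> D w -> onorm (F z - F w) <= 2.

Lemma caffine0_disc z w : nsq z <= 1 -> D w -> D (caffine 0 z w).
Proof.
move=> z1 w1; rewrite /D /= nsq_caffine0 (le_lt_trans _ w1)//.
by rewrite ler_piMl ?nsq_ge0.
Qed.

Lemma caffine0_real z t : caffine 0 z (t, 0) = (t * z.1, t * z.2).
Proof. by rewrite /caffine /lin2 /=; congr pair; ring. Qed.

(** [A0] is the real part of [z - w] times the complex derivative at 0 of the component along [u].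
    Points of the unit circle are allowed, such as 1 and -1 below. *)
Lemma schwarz_two_points z w u : nsq z <= 1 -> nsq w <= 1 -> onorm u = 1 ->
  let P (v : R * R) := dot (F (caffine 0 z v) - F (caffine 0 w v)) u in
  let Q (v : R * R) := dot (F (caffine 0 z v) - F (caffine 0 w v)) (omul I u) in
  let A0 := dot (dF 0) u * (z.1 - w.1) - dot (dF 0) (omul I u) * (z.2 - w.2) in
  [/\ forall v : R * R, nsq v < 1 -> v.1 * P v + v.2 * Q v <= 2 * nsq v, A0 <= 2 &
      A0 = 2 \/ (exists v : R * R, [/\ nsq v < 1, v != 0 & v.1 * P v + v.2 * Q v = 2 * nsq v]) ->
      A0 = 2 /\ forall v : R * R, nsq v < 1 -> v.1 * P v + v.2 * Q v = 2 * nsq v].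
Proof.
move=> z1 w1 u1 P Q A0.
have hz := holo_sub (fun v : R * R => caffine0_disc z1 (w := v))
  (holo_caffine (c := 0) (m := z) (slice_holo u)).
have hw := holo_sub (fun v : R * R => caffine0_disc w1 (w := v))
  (holo_caffine (c := 0) (m := w) (slice_holo u)).
have := holoD hz (holoN hw).
set A := (X in holo _ _ _ X _); set B := (X in holo _ _ _ _ X) => h.
have {}h : holo D P Q A B.
  by apply: holo_near h => v _; near=> v' => /=; rewrite /P /Q !dotBl; split.
have A00 : A 0 = A0 by rewrite /A /A0; cbv beta; rewrite !caffine0; ring.
have [||v v1|H1 H2 H3] := schwarz (ler0n R 2) h.
- by rewrite /P !caffine0 subrr dot0l.
- by rewrite /Q !caffine0 subrr dot0l.
- apply: le_trans (bessel SI _ _) _; rewrite -!onorm_sqr u1 expr1n mulr1.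
  by rewrite ler_pXn2r// ?nnegrE ?onorm_ge0//; apply: diam2; exact: caffine0_disc.
- by rewrite -A00; split.
Unshelve. all: by end_near. Qed.

(** At the parameter [(r, 0)] the Schwarz bound reads [r * P <= 2 * r ^+ 2]; all unit vectors [u]
    together give the norm. *)
Lemma slice_lipschitz z w (r : R) : 0 < r < 1 -> nsq z <= 1 -> nsq w <= 1 ->
  onorm (F (r * z.1, r * z.2) - F (r * w.1, r * w.2)) <= 2 * r.
Proof.
move=> /andP[r0 r1] z1 w1; apply: onorm_le_dot => [|u u1].
  by rewrite mulr_ge0// ltW.
have [H _ _] := schwarz_two_points z1 w1 u1.
have r2 : nsq (r, 0 : R) = r * r by rewrite /nsq /= expr0n addr0 expr2.
have := H (r, 0); rewrite r2 !caffine0_real /= mul0r addr0.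
rewrite [2 * _]mulrCA ler_pM2l//; apply.
by rewrite -expr2 expr_lt1// ltW.
Qed.

Lemma slice_lipschitz_circle z w : 0 < nsq z < 1 -> nsq w = nsq z ->
  onorm (F z - F w) <= 2 * Num.sqrt (nsq z).
Proof.
move=> /andP[z0 z1] wz; set r := Num.sqrt (nsq z).
have r0 : 0 < r by rewrite sqrtr_gt0.
have r2 : r ^+ 2 = nsq z by rewrite sqr_sqrtr// ltW.
have r1 : r < 1 by rewrite -(@ltr_pXn2r _ 2) ?nnegrE ?ltW// expr1n r2.
have n1 (v : R * R) : nsq v = nsq z -> nsq (v.1 / r, v.2 / r) <= 1.
  move=> vz; have -> : nsq (v.1 / r, v.2 / r) = nsq v / r ^+ 2.
    by rewrite /nsq /=; field; rewrite gt_eqF.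
  by rewrite vz r2 divff// gt_eqF.
have sc (v : R * R) : (r * (v.1 / r), r * (v.2 / r)) = v.
  by rewrite ![r * _]mulrC !divfK ?gt_eqF// -surjective_pairing.
have := slice_lipschitz (r := r) _ (n1 z erefl) (n1 w wz).
by rewrite !sc r0 r1; apply.
Qed.

(** For the points 1 and -1, [A0] is twice the component of the derivative at 0 along [u]. *)
Lemma onorm_slice_dx0_le1 : onorm (dF 0) <= 1.
Proof.
apply: onorm_le_dot => // u u1.
have n1 (x : R) : x ^+ 2 = 1 -> nsq (x, 0 : R) <= 1.
  by rewrite /nsq /= expr0n addr0 => ->.
have m1 : (-1 : R) ^+ 2 = 1 by rewrite sqrrN expr1n.
have [_ + _] := schwarz_two_points (n1 1 (expr1n _ _)) (n1 (-1) m1) u1.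
by rewrite /= subrr mulr0 subr0 => ?; lra.
Qed.

End Slice.

(** * The extremal case *)

Section SliceRigidity.
Variables (R : realType) (f : octonion R -> octonion R).
Hypothesis f_regular : slice_regular f (@oball R).
Implicit Types (z w : R * R) (u v : octonion R).
Variable I : octonion R.
Hypothesis SI : imag_sphere I.

Let D := [set z : R * R | nsq z < 1].
Local Notation F := (slice_fun f I).
Local Notation dF := (fun z => slice_dx f I z.1 z.2).
Local Notation a := (dF 0).

Hypothesis diam2 : forall z w, D z -> D w -> onorm (F z - F w) <= 2.

(** With [u] along the extremal difference, the Schwarz bound is attained at [(r, 0)], so [A0 = 2].
    By Cauchy-Schwarz and Bessel, [4 <= onorm a ^+ 2 * nsq (z - w)], and [nsq (z - w) <= 4]. *)
Lemma extremal_pair_deriv z w (r : R) : 0 < r < 1 -> nsq z <= 1 -> nsq w <= 1 ->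
  onorm (F (r * z.1, r * z.2) - F (r * w.1, r * w.2)) = 2 * r -> 1 <= onorm a.
Proof.
move=> /andP[r0 r1] z1 w1; set V := F _ - F _ => VE.
have V0 : onorm V != 0 by rewrite VE mulf_neq0// gt_eqF.
pose u := (onorm V)^-1 *: V.
have u1 : onorm u = 1.
  by rewrite /u onormZ normfV ger0_norm ?onorm_ge0// mulVf.
have Vu : dot V u = 2 * r by rewrite /u dotZr -onorm_sqr -VE; field.
have [_ _ H] := schwarz_two_points f_regular SI diam2 z1 w1 u1.
have [|A0 _] := H.
  right; exists (r, 0); split.
  - by rewrite /nsq /= expr0n addr0 expr_lt1// ltW.
  - by rewrite -nsq_gt0 /nsq /= expr0n addr0 exprn_gt0.
  - by rewrite !caffine0_real -/V Vu /nsq /=; ring.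
have B := bessel SI u a.
rewrite -!onorm_sqr u1 expr1n mulr1 in B.
(* The parallelogram law. *)
have zw : nsq (z - w) <= 4.
  have -> : nsq (z - w) = 2 * nsq z + 2 * nsq w - nsq (z + w) by rewrite /nsq /=; ring.
  by have := nsq_ge0 (z + w); lra.
have C := cauchy_schwarz2 (dot a u) (- dot a (omul I u)) (z.1 - w.1) (z.2 - w.2).
rewrite mulNr A0 sqrrN in C.
have a2 : 1 <= onorm a ^+ 2.
  have : (dot a u ^+ 2 + dot a (omul I u) ^+ 2) * nsq (z - w) <= onorm a ^+ 2 * 4.
    by apply: ler_pM => //; [rewrite addr_ge0 ?sqr_ge0|exact: nsq_ge0].
  move: C; rewrite -/(nsq (z.1 - w.1, z.2 - w.2)) -/(z - w) => C C'.
  by have := le_trans C C'; lra.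
by rewrite -(@ler_pXn2r _ 2) ?nnegrE ?onorm_ge0// expr1n.
Qed.

Hypothesis a1 : onorm a = 1.

Let P z := dot (F z) a.
Let Q z := dot (F z) (omul I a).

Let neg z : caffine 0 (-1, 0) z = - z.
Proof.
by case: z => x y; rewrite -[RHS]/(- x, - y) /caffine /lin2 /=; congr pair; ring.
Qed.

Let pos z : caffine 0 (1, 0) z = z.
Proof. by case: z => x y; rewrite /caffine /lin2 /=; congr pair; ring. Qed.

(** For [u = a] and the points 1 and -1, [A0] is [2 * onorm a ^+ 2 = 2], so the equality case of the
    Schwarz lemma applies. *)
Lemma antipodal_extremal z : D z ->
  z.1 * (P z - P (- z)) + z.2 * (Q z - Q (- z)) = 2 * nsq z.
Proof.
move=> Dz.
have n1 (x : R) : x ^+ 2 = 1 -> nsq (x, 0 : R) <= 1.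
  by rewrite /nsq /= expr0n addr0 => ->.
have m1 : (-1 : R) ^+ 2 = 1 by rewrite sqrrN expr1n.
have [_ _ H] := schwarz_two_points f_regular SI diam2
  (n1 1 (expr1n _ _)) (n1 (-1) m1) a1.
have [|_ {}H] := H.
  left; rewrite /= -onorm_sqr a1 expr1n mul1r opprK subrr mulr0 subr0.
  by [].
by have := H z Dz; rewrite neg pos !dotBl.
Qed.

(* On the circle through [z], the component of [F z - F w] along [z a] is maximal
   at [w = - z]; its angular derivative there is [|z|^2] times the component of
   the slice derivative along [I a]. *)
Lemma slice_dx_skew0 z : D z -> dot (dF z) (omul I a) = 0.
Proof.
move=> Dz; have [->|z0] := eqVneq z 0.
  by rewrite dot_sphere_orth.
pose w := - z.
have nw : nsq w = nsq z by rewrite /nsq /= !sqrrN.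
have zw : z = - w by rewrite opprK.
have w0 : 0 < nsq w by rewrite nw nsq_gt0.
have w1 : nsq w < 1 by rewrite nw.
pose c (s : R) := (z.1 * cos s - z.2 * sin s, z.1 * sin s + z.2 * cos s).
have nc s : nsq (c s) = nsq z.
  have -> : nsq (c s) = nsq z * (cos s ^+ 2 + sin s ^+ 2) by rewrite /nsq /c /=; ring.
  by rewrite cos2Dsin2 mulr1.
have c0 : c 0 = z by rewrite /c cos0 sin0 !mulr1 !mulr0 subr0 add0r -surjective_pairing.
have Dc s : D (c s) by rewrite /D /= nc.
pose psi s := w.1 * P (c s) + w.2 * Q (c s).
(* The component of [F w - F (c s)] along [w a] is at most [2 * nsq w], with equality at [s = 0],
   where [c 0 = z = - w]. *)
have psi_ge s : psi 0 <= psi s.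
  have E := antipodal_extremal w1; rewrite -zw in E.
  have lip := slice_lipschitz_circle f_regular SI diam2 (z := w) (w := c s).
  have {}lip := lip _ (etrans (nc s) (esym nw)).
  have cs := cauchy_schwarz (F w - F (c s)) (omul (cpoint I w.1 w.2) a).
  have n2 : onorm (cpoint I w.1 w.2) = Num.sqrt (nsq w).
    apply/eqP; rewrite -(@eqrXn2 _ 2) ?onorm_ge0 ?sqrtr_ge0//.
    by rewrite onorm_cpoint// sqr_sqrtr// nsq_ge0.
  move: cs; rewrite onormM a1 mulr1 n2 => cs.
  have {cs}cs : dot (F w - F (c s)) (omul (cpoint I w.1 w.2) a) <= 2 * nsq w.
    apply: le_trans cs _; rewrite -[nsq w in leRHS]sqr_sqrtr ?nsq_ge0// expr2 mulrA.
    by rewrite ler_wpM2r ?sqrtr_ge0//; apply: lip; rewrite w0.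
  move: cs; rewrite omul_cpoint dotDr !dotZr !dotBl -/(P _) -/(Q _) -/(P _) -/(Q _).
  by rewrite /psi c0; lra.
have dpsi (s : R) : is_derive s 1 psi
    (w.1 * (dot (dF (c s)) a * (- (z.1 * sin s) - z.2 * cos s) +
       - dot (dF (c s)) (omul I a) * (z.1 * cos s - z.2 * sin s)) +
     w.2 * (dot (dF (c s)) (omul I a) * (- (z.1 * sin s) - z.2 * cos s) +
       dot (dF (c s)) a * (z.1 * cos s - z.2 * sin s))).
  have [dP dQ _ _] := slice_holo f_regular SI a (Dc s).
  have d1 : is_derive s 1 (fun s => z.1 * cos s - z.2 * sin s)
      (- (z.1 * sin s) - z.2 * cos s).
    by apply: is_derive_eq; rewrite /GRing.scale /= mulrN.
  have d2 : is_derive s 1 (fun s => z.1 * sin s + z.2 * cos s)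
      (z.1 * cos s - z.2 * sin s).
    by apply: is_derive_eq; rewrite /GRing.scale /= mulrN.
  have dP' := is_diff_path dP d1 d2 erefl.
  have dQ' := is_diff_path dQ d1 d2 erefl.
  exact: is_deriveD (is_deriveZ w.1 dP') (is_deriveZ w.2 dQ').
have i0 : (0 : R) \in `]-1, 1[%R by rewrite in_itv /= ltr01 ltrN10.
have le11 : -1 <= 1 :> R by lra.
have dpsi' (s : R) : s \in `]-1, 1[%R -> derivable psi s 1 by move=> _; case: (dpsi s).
have [_ min0] := derive1_at_min le11 dpsi' i0 (fun s _ => psi_ge s).
have [_ {}dpsi] := dpsi 0; move: min0; rewrite dpsi c0 sin0 cos0 => E.
(* Substituting [w = - z], the terms in [dot (dF z) a] cancel. *)
have {}E : dot (dF z) (omul I a) * nsq z = 0.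
  by rewrite -[RHS]E /w /nsq /=; ring.
by move/eqP: E; rewrite mulf_eq0 nsq_eq0 (negbTE z0) orbF => /eqP.
Qed.

(** By [slice_dx_skew0] the [x]-derivative of [Q] vanishes, so [Q] depends on [y] alone. Its
    [y]-derivative, which is [dot (dF z) a], is then the same at [(x, 0)] as at 0, where it is
    [onorm a ^+ 2]. *)
Lemma slice_dx_real_comp (x : R) : x ^+ 2 < 1 -> dot (dF (x, 0)) a = 1.
Proof.
move=> x1.
have Dx : D (x, 0) by rewrite /D /nsq /= expr0n addr0.
have D00 : D 0 by rewrite /D /= nsq0.
have hQ z : D z -> is_diff z Q (lin2 (dot (dF z) (omul I a)) (dot (dF z) a)).
  by move=> Dz; have [] := slice_holo f_regular SI a Dz.
have QE (y : R) : x ^+ 2 + y ^+ 2 < 1 -> Q (x, y) = Q (0, y).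
  move=> xy; apply: (derive0_eq (g := fun s => Q (s, y))) => s sx.
  have Ds : D (s, y) by apply: le_lt_trans xy; rewrite /nsq /= lerD2r.
  have := is_diff_path (hQ _ Ds) (is_derive_id s 1) (is_derive_cst y s 1) erefl.
  by rewrite slice_dx_skew0// mul0r mulr0 addr0.
have d z : D z -> is_derive z.2 1 (fun y => Q (z.1, y)) (dot (dF z) a).
  move=> Dz; have dc := is_derive_cst z.1 z.2 1; have di := is_derive_id z.2 1.
  have := is_diff_path (hQ _ Dz) dc di (surjective_pairing z).
  by rewrite mulr0 mulr1 add0r.
have d1 : is_derive (0 : R) 1 (fun y => Q (x, y)) (dot (dF (x, 0)) a) := d _ Dx.
have d2 : is_derive (0 : R) 1 (fun y => Q (0, y)) (dot a a) := d _ D00.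
have n0 : \forall y \near (0 : R), Q (x, y) = Q (0, y).
  have cy : {for 0 : R, continuous (fun y : R => x ^+ 2 + y ^+ 2)}.
    by apply: cvgD; [exact: cvg_cst|exact: exprn_continuous].
  move/cvgr_lt : cy => /(_ 1); rewrite expr0n addr0 => /(_ x1).
  by apply: filterS => y; exact: QE.
have [_ E1] := near_eq_is_derive n0 d1; have [_ E2] := d2.
by rewrite -E1 E2 -onorm_sqr a1 expr1n.
Qed.

End SliceRigidity.

(** * From a constant derivative on the real axis to an affine function *)

Section SliceAffine.
Variables (R : realType) (f : octonion R -> octonion R).
Hypothesis f_regular : slice_regular f (@oball R).
Implicit Types (z w : R * R) (u v a I : octonion R).

(** Integrating along the real axis, the components of [f] and of the affine map agree there; the
    identity theorem for their difference extends this to the slice. *)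
Lemma slice_affine a I : imag_sphere I ->
  (forall x : R, x ^+ 2 < 1 -> derive1 (f \o @oreal R) x = a) ->
  forall z, nsq z < 1 -> slice_fun f I z = f 0 + omul (cpoint I z.1 z.2) a.
Proof.
move=> SI da z z1; apply: dot_ext => u.
have axis u' (x : R) : x ^+ 2 < 1 ->
    dot (slice_fun f I (x, 0)) u' = dot (f 0) u' + x * dot a u'.
  move=> x1; pose g (s : R) := dot (slice_fun f I (s, 0)) u' - s * dot a u'.
  suff gE : g x = g 0.
    by move: gE; rewrite /g mul0r slice_fun0 subr0 => <-; rewrite subrK.
  apply: derive0_eq => s sx; have s1 : nsq (s, 0 : R) < 1.
    by rewrite /nsq /= expr0n addr0 (le_lt_trans sx).
  have [d _ _ _ _] := f_regular SI ((oball_cpoint SI s 0).2 s1).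
  have d1 := is_derive_dot u' d.
  have d2 : is_derive s 1 (fun s => s * dot a u') (dot a u').
    by apply: is_derive_eq; rewrite scaler0 add0r /GRing.scale /= mulr1.
  apply: (is_derive_eq (is_deriveB d1 d2)).
  by rewrite -/(slice_dx f I s 0) slice_dx_real da ?subrr// (le_lt_trans sx).
have hA := slice_holo f_regular SI u.
pose al := dot a u; pose be := dot a (omul I u).
(* The components of [f 0 + w a] along [u] and [omul I u], with constant derivative [al + i be]. *)
have hL : holo [set z : R * R | nsq z < 1]
    (fun w => dot (f 0) u + lin2 al (- be) w)
    (fun w => dot (f 0) (omul I u) + lin2 be al w) (fun=> al) (fun=> be).
  move=> w _; split; [exact: is_diff_lin2_affine|exact: is_diff_lin2_affine|..].
    exact: cvg_cst.
  exact: cvg_cst.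
have := holo_eq0_axis (holoD hA (holoN hL)) _ z1; rewrite /=.
move=> H; have {}H := H _; apply/eqP; rewrite -subr_eq0; apply/eqP.
rewrite omul_cpoint !dotDl !dotZl dot_sphere_skew//.
have -> : dot (f 0) u + (z.1 * dot a u + z.2 * - dot a (omul I u)) =
  dot (f 0) u + lin2 al (- be) z by rewrite /lin2 /al /be; ring.
apply: H => x x1; rewrite !axis// /lin2 /al /be /=; split; ring.
Qed.

End SliceAffine.

(** * Diameters of slice images and their attainment *)

Section Diameter.
Variables (R : realType) (f : octonion R -> octonion R).
Implicit Types (z w : R * R) (u v a I : octonion R) (r : R).

Lemma dot_delta u k : dot u (delta_mx 0 k) = u 0 k.
Proof.
rewrite /dot (bigD1 k)//= big1 => [|i ik]; first by rewrite mxE !eqxx mulr1 addr0.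
by rewrite mxE (negbTE ik) andbF mulr0.
Qed.

Lemma scale_cpoint I r x y : r *: cpoint I x y = cpoint I (r * x) (r * y).
Proof. by rewrite /Defs.cpoint /oreal scalerDr !scalerA. Qed.

Lemma slice_cpoint I z : imag_sphere I -> nsq z < 1 ->
  slice (@oball R) I (cpoint I z.1 z.2).
Proof.
move=> SI z1; split; last by exists z.
by apply/(oball_cpoint SI); rewrite -surjective_pairing.
Qed.

Lemma slice_diam_lipschitz : slice_diam f (@oball R) = 2%:E ->
  forall I z w, imag_sphere I -> nsq z < 1 -> nsq w < 1 ->
  onorm (slice_fun f I z - slice_fun f I w) <= 2.
Proof.
move=> fd I z w SI z1 w1; rewrite -lee_fin -fd.
apply: (@le_trans _ _ (diam (f @` slice (@oball R) I))); last first.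
  by apply: ereal_sup_ubound; exists I.
apply: ereal_sup_ubound; exists (slice_fun f I z, slice_fun f I w) => //.
by split; [exists (cpoint I z.1 z.2)|exists (cpoint I w.1 w.2)] => //;
  exact: slice_cpoint.
Qed.

Lemma diam_scaled_slice_le I r (c : R) : imag_sphere I ->
  (forall z w, nsq z < 1 -> nsq w < 1 ->
    onorm (slice_fun f I (r * z.1, r * z.2) - slice_fun f I (r * w.1, r * w.2)) <= c) ->
  (diam (f @` [set r *: w | w in slice (@oball R) I]) <= c%:E)%E.
Proof.
move=> SI H; apply: ge_ereal_sup => _ [[p q] [/= [_ [w1 [b1 [z1 _ E1]] <-] <-]
  [_ [w2 [b2 [z2 _ E2]] <-] <-]] <-]; subst w1 w2.
have {}b1 := (oball_cpoint SI _ _).1 b1; have {}b2 := (oball_cpoint SI _ _).1 b2.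
rewrite lee_fin /= !scale_cpoint; apply: H.
  by rewrite [z1]surjective_pairing.
by rewrite [z2]surjective_pairing.
Qed.

Hypothesis f_regular : slice_regular f (@oball R).

(** Scaled by [r < 1], the closed unit disc stays in the open one, where the slice function is
    continuous; the distance therefore has a maximum over the compact product of two closed
    discs. *)
Lemma slice_dist_max I r : imag_sphere I -> 0 < r < 1 ->
  exists z w, [/\ nsq z <= 1, nsq w <= 1 & forall z' w', nsq z' < 1 -> nsq w' < 1 ->
    onorm (slice_fun f I (r * z'.1, r * z'.2) - slice_fun f I (r * w'.1, r * w'.2)) <=
    onorm (slice_fun f I (r * z.1, r * z.2) - slice_fun f I (r * w.1, r * w.2))].
Proof.
move=> SI /andP[r0 r1].
pose D1 := [set z : R * R | nsq z <= 1 ^+ 2].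
pose V (p : (R * R) * (R * R)) :=
  slice_fun f I (caffine 0 (r, 0) p.1) - slice_fun f I (caffine 0 (r, 0) p.2).
have VE z w : V (z, w) =
    slice_fun f I (r * z.1, r * z.2) - slice_fun f I (r * w.1, r * w.2).
  have cE (v : R * R) : caffine 0 (r, 0) v = (r * v.1, r * v.2).
    by rewrite /caffine /lin2 /=; congr pair; ring.
  by rewrite /V /= !cE.
have inD z : D1 z -> nsq (caffine 0 (r, 0) z) < 1.
  rewrite /D1 /= expr1n nsq_caffine0 => z1; have -> : nsq (r, 0 : R) = r ^+ 2.
    by rewrite /nsq /= expr0n addr0.
  by rewrite (le_lt_trans (ler_piMr (sqr_ge0 r) z1))// expr_lt1// ltW.
have cF u z : D1 z ->
    {for z, continuous (fun z => dot (slice_fun f I (caffine 0 (r, 0) z)) u)}.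
  move=> /inD Dz; have [c _] := holo_continuous (slice_holo f_regular SI u) Dz.
  exact: (@continuous_comp _ _ _ _ (fun z => dot (slice_fun f I z) u) _
    (@caffine_continuous R 0 (r, 0) z) c).
have cV u p : (D1 `*` D1) p -> {for p, continuous (fun p => dot (V p) u)}.
  move=> [D1p D2p]; have c1 : {for p, continuous (@fst (R * R)%type (R * R)%type)}.
    exact: cvg_fst.
  have c2 : {for p, continuous (@snd (R * R)%type (R * R)%type)} by exact: cvg_snd.
  have k1 := @continuous_comp _ _ _ _
    (fun z => dot (slice_fun f I (caffine 0 (r, 0) z)) u) _ c1 (cF u p.1 D1p).
  have k2 := @continuous_comp _ _ _ _
    (fun z => dot (slice_fun f I (caffine 0 (r, 0) z)) u) _ c2 (cF u p.2 D2p).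
  have -> : (fun p => dot (V p) u) = (fun p =>
      dot (slice_fun f I (caffine 0 (r, 0) p.1)) u - dot (slice_fun f I (caffine 0 (r, 0) p.2)) u).
    by apply/funext => q; rewrite dotBl.
  exact: cvgB k1 k2.
have cG : {within D1 `*` D1, continuous (fun p => dot (V p) (V p))}.
  apply/continuous_in_subspaceT => p; rewrite inE => Dp.
  (* Continuity is available for components along a fixed vector, so the square norm is split into
     coordinates. *)
  have -> : (fun p => dot (V p) (V p)) = \sum_k (fun p => V p 0 k * V p 0 k).
    by apply/funext => q; rewrite fct_sumE.
  apply: (big_ind (fun g : (R * R) * (R * R) -> R => {for p, continuous g})).
  - exact: cvg_cst.
  - by move=> g1 g2; exact: cvgD.
  - move=> k _; have c : {for p, continuous (fun p => V p 0 k)}.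
      rewrite (_ : (fun p => V p 0 k) = fun p => dot (V p) (delta_mx 0 k)).
        exact: cV.
      by apply/funext => q; rewrite dot_delta.
    exact: cvgM.
have [||[z w] zw Hmax] := compact_EVT_max _ _ cG.
- by exists (0, 0); split; rewrite /D1 /= nsq0 expr1n.
- by apply: compact_setX; exact: disc_compact.
exists z, w; move: zw; rewrite inE /D1 /= expr1n => -[z1 w1]; split => // z' w' z'1 w'1.
rewrite -!VE -(@ler_pXn2r _ 2) ?nnegrE ?onorm_ge0// !onorm_sqr.
by apply: Hmax; rewrite inE; split; rewrite /D1 /= expr1n ltW.
Qed.

End Diameter.

Theorem theorem1p5 (R : realType) (f : octonion R -> octonion R)
    (f_regular : slice_regular f (@oball R))
    (f_diam : slice_diam f (@oball R) = 2%:E) :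
  [/\ forall (r : R) (I : octonion R), 0 < r < 1 -> imag_sphere I ->
        (diam (f @` [set r *: w | w in slice (@oball R) I]) <= (2 * r)%:E)%E,
      onorm (slice_deriv f 0) <= 1 &
      (exists (r0 : R) (I0 : octonion R),
         [/\ 0 < r0 < 1, imag_sphere I0 &
             diam (f @` [set r0 *: w | w in slice (@oball R) I0])
               = (2 * r0)%:E])
      \/ onorm (slice_deriv f 0) = 1
      <->
      forall w, oball w -> f w = f 0 + omul w (slice_deriv f 0)].
Proof.
have lip := slice_diam_lipschitz f_diam.
have dE I : slice_dx f I 0 0 = slice_deriv f 0.
  by rewrite slice_dx_real (slice_deriv0E f_regular).
have d1 : onorm (slice_deriv f 0) <= 1.
  have SI := imag_unit0 R; rewrite -(dE (imag_unit 0)).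
  exact: (onorm_slice_dx0_le1 f_regular SI (fun z w => lip _ z w SI)).
split=> //.
  move=> r I r01 SI; apply: diam_scaled_slice_le => // z w z1 w1.
  exact: (slice_lipschitz f_regular SI (fun z w => lip _ z w SI) r01 (ltW z1) (ltW w1)).
split.
- move=> eqs; have {}eqs : onorm (slice_deriv f 0) = 1.
    (* Equality in (a) reduces to equality in (b): a pair at maximal distance realises the diameter,
       so its distance is exactly [2 * r]. *)
    case: eqs => // -[r [I [r01 SI E]]]; apply/eqP; rewrite eq_le d1 /=.
    have [z [w [z1 w1 Hmax]]] := slice_dist_max f_regular SI r01.
    have := diam_scaled_slice_le SI Hmax; rewrite E lee_fin => lb.
    have ub := slice_lipschitz f_regular SI (fun z w => lip _ z w SI) r01 z1 w1.
    have := extremal_pair_deriv f_regular SI (fun z w => lip _ z w SI) r01 z1 w1.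
    by rewrite /= dE; apply; apply/eqP; rewrite eq_le ub.
  (* On the real axis, the difference of the two derivatives is orthogonal to [f'(0)] and to every
     [I f'(0)], hence zero. *)
  have dx (x : R) : x ^+ 2 < 1 -> derive1 (f \o @oreal R) x = slice_deriv f 0.
    move=> x1; apply/eqP; rewrite -subr_eq0; apply/eqP.
    have key I : imag_sphere I ->
        dot (derive1 (f \o @oreal R) x - slice_deriv f 0) (slice_deriv f 0) = 0 /\
        dot (derive1 (f \o @oreal R) x - slice_deriv f 0) (omul I (slice_deriv f 0)) = 0.
      move=> SI; have a1 : onorm (slice_dx f I 0 0) = 1 by rewrite dE.
      have L := fun z w => lip I z w SI.
      have H1 := slice_dx_real_comp f_regular SI L a1 x1.
      have x1' : nsq (x, 0 : R) < 1 by rewrite /nsq /= expr0n addr0.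
      have H2 := slice_dx_skew0 f_regular SI L a1 x1'.
      move: H1 H2; rewrite /= dE slice_dx_real => H1 H2.
      by rewrite !dotBl H1 H2 dot_sphere_orth// -onorm_sqr eqs expr1n !subrr.
    apply: (orth_slices_eq0 eqs); first by have [] := key _ (imag_unit0 R).
    by move=> I /key[].
  move=> w bw; have [I [x [y [SI wE]]]] := exists_cpoint w.
  have xy : nsq (x, y) < 1 by apply/(oball_cpoint SI); rewrite -wE.
  by have := slice_affine f_regular SI dx xy; rewrite /slice_fun /= -wE.
- move=> aff; right; apply/eqP; rewrite eq_le d1 /=.
  set a := slice_deriv f 0 in aff *.
  (* The affine map scales distances on each slice by [onorm a], so its slice diameter, which is 2,
     is at most [2 * onorm a]. *)
  suff : (2%:E <= (2 * onorm a)%:E :> \bar R)%E by rewrite lee_fin; lra.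
  rewrite -[X in (X <= _)%E]f_diam; apply: ge_ereal_sup => _ [I SI <-].
  apply: ge_ereal_sup => _ [[p q] [/= [v1 [b1 [z _ E1]] <-]
    [v2 [b2 [w _ E2]] <-]] <-]; subst v1 v2.
  rewrite lee_fin /= (aff _ b1) (aff _ b2) opprD addrACA subrr add0r !omul_cpoint.
  have -> : z.1 *: a + z.2 *: omul I a - (w.1 *: a + w.2 *: omul I a) =
      omul (cpoint I (z.1 - w.1) (z.2 - w.2)) a.
    by rewrite omul_cpoint !scalerBl opprD addrACA.
  rewrite onormM ler_wpM2r ?onorm_ge0//.
  have z1 := (oball_cpoint SI _ _).1 b1; have w1 := (oball_cpoint SI _ _).1 b2.
  rewrite -(@ler_pXn2r _ 2) ?nnegrE ?onorm_ge0// onorm_cpoint//.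
  move: z1 w1; rewrite /nsq /=.
  by have := sqr_ge0 (z.1 + w.1); have := sqr_ge0 (z.2 + w.2); nra.
Qed.
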